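(* Let $\mathrm{Hom}\big((\mathcal H,\overline{\sqcup\!\sqcup},\Delta_{\ge1}),(\mathcal H,\ast,\Delta_{\rm dec})\big)$ be the set of graded Hopf algebra homomorphisms of degree $0$ from $(\mathcal H,\overline{\sqcup\!\sqcup},\Delta_{\ge1})$ to $(\mathcal H,\ast,\Delta_{\rm dec})$, and let $\mathrm{Isom}\big((\mathcal H,\overline{\sqcup\!\sqcup},\Delta_{\ge1}),(\mathcal H,\ast,\Delta_{\rm dec})\big)$ be the set of graded Hopf algebra isomorphisms of degree $0$. Then the map $$\Psi:\big\{\chi:(\mathcal H,\overline{\sqcup\!\sqcup})\to\mathbb Q \;\big|\; \chi\text{ is a character}\big\}\to \mathrm{Hom}\big((\mathcal H,\overline{\sqcup\!\sqcup},\Delta_{\ge1}),(\mathcal H,\ast,\Delta_{\rm dec})\big),\qquad \chi\mapsto\Psi_\chi,$$ is bijective. Furthermore, it restricts to a bijection $$\big\{\chi:(\mathcal H,\overline{\sqcup\!\sqcup})\to\mathbb Q \text{ a character}\;\big|\; \chi([s])\neq0\ \ \forall s\in\mathbb Z_{\ge1}\big\}\to \mathrm{Isom}\big((\mathcal H,\overline{\sqcup\!\sqcup},\Delta_{\ge1}),(\mathcal H,\ast,\Delta_{\rm dec})\big).$$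
   Context: Let $\mathcal H=\mathbb Q\mathbf 1\oplus\bigoplus_{k\ge1,\ \vec s\in\mathbb Z_{\ge1}^k}\mathbb Q[\vec s]$ be the $\mathbb Q$-vector space with basis $\mathbf 1=[\emptyset]$ and the symbols $[\vec s]=[s_1,\dots,s_k]$. The depth of $[\vec s]$ is $\mathrm{dep}(\vec s)=k$ and its weight is $s_1+\cdots+s_k$ ($\mathbf 1$ has depth and weight $0$). Let $H_n$ be the set of basis elements of weight $n$; $\mathcal H=\bigoplus_{n\ge0}\mathbb Q H_n$ is the weight grading. Notation: $[1_k]=[1,\dots,1]$ ($k$ ones), $[1_0]=\mathbf 1$. MZV shuffle Hopf algebra $(\mathcal H,\overline{\sqcup\!\sqcup},\Delta_{\ge1})$. Let $\rho:\mathcal H\to\mathbb Q\oplus\mathbb Q\langle x_0,x_1\rangle x_1$ be the linear bijection $\mathbf 1\mapsto\mathbf 1$, $[s_1,\dots,s_k]\mapsto x_0^{s_1-1}x_1\cdots x_0^{s_k-1}x_1$. The product $\overline{\sqcup\!\sqcup}$ on $\mathcal H$ is the pullback along $\rho$ of the usual shuffle product of words in $x_0,x_1$ (defined by $w\sqcup\!\sqcup\mathbf 1=\mathbf 1\sqcup\!\sqcup w=w$, $aw_1\sqcup\!\sqcup bw_2=a(w_1\sqcup\!\sqcup bw_2)+b(aw_1\sqcup\!\sqcup w_2)$). For $i\ge1$ let $\delta_i:\mathcal H\to\mathcal H$ be linear with $\delta_i(\mathbf 1)=0$, $\delta_i([s_1,\dots,s_k])=\sum_{j=1}^i s_j[s_1,\dots,s_j+1,\dots,s_k]$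 if $i\le k$, and $0$ if $i>k$; set $\delta_i=0$ for $i\le0$. Define $\mathrm{id}\,\circledS\,\delta_i:\mathcal H\otimes\mathcal H\to\mathcal H\otimes\mathcal H$ by $[\vec s]\otimes[\vec t]\mapsto[\vec s]\otimes\delta_{i-\mathrm{dep}(\vec s)}([\vec t])$. Then $\Delta_{\ge1}:\mathcal H\to\mathcal H\otimes\mathcal H$ is the unique linear map (known to exist) with $\Delta_{\ge1}(\mathbf 1)=\mathbf 1\otimes\mathbf 1$, $\Delta_{\ge1}([1_k])=\sum_{j=0}^k[1_j]\otimes[1_{k-j}]$, and $(\mathrm{id}\,\circledS\,\delta_i+\delta_i\otimes\mathrm{id})\Delta_{\ge1}=\Delta_{\ge1}\delta_i$ for all $i\ge1$. It is known that $(\mathcal H,\overline{\sqcup\!\sqcup},\Delta_{\ge1})$, with unit $\mathbf 1$ and counit $\mathbf 1\mapsto1$, $[\vec s]\mapsto0$, is a connected Hopf algebra graded by weight. MZV quasi-shuffle Hopf algebra $(\mathcal H,\ast,\Delta_{\rm dec})$. Regarding $[s_1,\dots,s_k]$ as a word in the letters $\mathbb Z_{\ge1}$, the product $\ast$ is defined by $w\ast\mathbf 1=\mathbf 1\ast w=w$, $aw_1\ast bw_2=a(w_1\ast bw_2)+b(aw_1\ast w_2)+(a+b)(w_1\ast w_2)$ for letters $a,b\in\mathbb Z_{\ge1}$ (where $a+b$ is a single letter), and $\Delta_{\rm dec}([s_1,\dots,s_k])=\sum_{i=0}^k[s_1,\dots,s_i]\otimes[s_{i+1},\dots,s_k]$;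 same unit, counit and weight grading. It is a connected graded Hopf algebra. A character of $(\mathcal H,\overline{\sqcup\!\sqcup})$ is a (unital) algebra homomorphism $\chi:(\mathcal H,\overline{\sqcup\!\sqcup})\to\mathbb Q$. Given such $\chi$, $\Psi_\chi:(\mathcal H,\overline{\sqcup\!\sqcup},\Delta_{\ge1})\to(\mathcal H,\ast,\Delta_{\rm dec})$ denotes the unique graded Hopf algebra homomorphism with $\chi_Q'\circ\Psi_\chi=\chi$, where $\chi_Q':(\mathcal H,\ast)\to\mathbb Q$ is the character $\chi_Q'(\mathbf 1)=1$, $\chi_Q'([s_1])=1$, $\chi_Q'([s_1,\dots,s_k])=0$ for $k>1$ (existence and uniqueness are known, by the Aguiar–Bergeron–Sottile universal property of quasi-symmetric functions). Explicitly, $\Psi_\chi(\mathbf 1)=\mathbf 1$ and for $[\vec s]\in H_n$, $n\ge1$, $\Psi_\chi([\vec s])=\sum_{\alpha}\chi_\alpha([\vec s])[\alpha_1,\dots,\alpha_m]$, summed over compositions $\alpha=(\alpha_1,\dots,\alpha_m)$ of $n$, where $\chi_\alpha=\chi^{\otimes m}\circ\pi_\alpha\circ\Delta_{\ge1}^{(m-1)}$, $\Delta_{\ge1}^{(m-1)}:\mathcal H\to\mathcal H^{\otimes m}$ is the iterated coproduct ($\Delta_{\ge1}^{(0)}=\mathrm{id}$) and $\pi_\alpha:\mathcal H^{\otimes m}\to\mathbb QH_{\alpha_1}\otimes\cdots\otimes\mathbb QH_{\alpha_m}$ is the tensor product of the projections onto homogeneous components. *)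

(* Defs.v *)
From HB Require Import structures.
From mathcomp Require Import all_boot all_order all_algebra.
From mathcomp Require Import finmap monalg.
From mathcomp Require Import boolp classical_sets functions.

Set Implicit Arguments.
Unset Strict Implicit.
Unset Printing Implicit Defensive.

Import GRing.Theory.
Local Open Scope ring_scope.

(* The free Q-vector space on a choiceType K is {malg rat[K]}; <<k>> is the
   basis vector of index k and u@_k the coefficient of u at k.  Free modules
   on K and K' have tensor product {malg rat[K * K']}. *)

Section LinearExtension.
Variables (K : choiceType) (M : lmodType rat) (f : K -> M).

Definition lext (u : {malg rat[K]}) : M := \sum_(k <- msupp u) u@_k *: f k.

Lemma lextEw (d : {fset K}) (u : {malg rat[K]}) :
  (msupp u `<=` d)%fset -> lext u = \sum_(k <- d) u@_k *: f k.
Proof.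
move=> sub; rewrite /lext (big_fset_incl _ sub) //= => k _ /mcoeff_outdom ->.
by rewrite scale0r.
Qed.

Lemma lext_is_linear : linear lext.
Proof.
move=> a u v; pose d := (msupp u `|` msupp v)%fset.
rewrite (@lextEw d (a *: u + v)); last first.
  apply: fsubset_trans (msuppD_le _ _) _; apply: fsetSU; exact: msuppZ_le.
rewrite (@lextEw d u) ?fsubsetUl // (@lextEw d v) ?fsubsetUr //.
rewrite scaler_sumr -big_split /=; apply: eq_bigr => k _.
by rewrite mcoeffD mcoeffZ scalerDl scalerA.
Qed.

HB.instance Definition _ :=
  GRing.isLinear.Build rat {malg rat[K]} M _ lext lext_is_linear.

Lemma lextU k : lext << k >> = f k.
Proof. by rewrite /lext msuppU oner_eq0 big_seq_fset1 mcoeffUU scale1r. Qed.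

End LinearExtension.

Lemma malg_linear_eq (K : choiceType) (M : lmodType rat)
    (f g : {linear {malg rat[K]} -> M}) :
  (forall k, f << k >> = g << k >>) -> f =1 g.
Proof.
move=> fg u; have -> : u = \sum_(k <- msupp u) u@_k *: << k >>.
  rewrite {1}(monalgE u); apply: eq_bigr => k _; apply/malgP => x.
  by rewrite mcoeffZ !mcoeffU mulrnAr mulr1.
by rewrite !linear_sum; apply: eq_bigr => k _; rewrite !linearZ fg.
Qed.

Section Tensor.
Variables K K' : choiceType.

Definition tens (u : {malg rat[K]}) (v : {malg rat[K']}) :
    {malg rat[(K * K')%type]} :=
  lext (fun k => lext (fun k' => << (k, k') >>) v) u.

Definition tmap (f : {malg rat[K]} -> {malg rat[K]})
    (g : {malg rat[K']} -> {malg rat[K']}) :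
    {malg rat[(K * K')%type]} -> {malg rat[(K * K')%type]} :=
  lext (fun p => tens (f << p.1 >>) (g << p.2 >>)).

HB.instance Definition _ f g := GRing.Linear.on (tmap f g).

Lemma tensUU k k' : tens << k >> << k' >> = << (k, k') >>.
Proof. by rewrite /tens !lextU. Qed.

Lemma tens_is_linearl v : linear (tens^~ v).
Proof. by move=> a u u'; rewrite /tens linearP. Qed.

Lemma tens_is_linearr u : linear (tens u).
Proof.
move=> a v v'; rewrite /tens /lext scaler_sumr -big_split /=.
apply: eq_bigr => k _; rewrite -!/(lext _ _) linearP scalerDr !scalerA.
by rewrite [a * _]mulrC.
Qed.

HB.instance Definition _ u :=
  GRing.isLinear.Build rat {malg rat[K']} _ _ (tens u) (tens_is_linearr u).

Definition tensr v u := tens u v.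
HB.instance Definition _ v :=
  GRing.isLinear.Build rat {malg rat[K]} _ _ (tensr v) (tens_is_linearl v).

End Tensor.

(* Indices: [s_1, ..., s_k] is a sequence of positive integers, whose depth is
   its size. *)

Definition posint := {n : nat | (0 < n)%N}.
Definition mkpos n : posint := exist _ n.+1 isT.
Definition pos1 : posint := mkpos 0.
Definition posS (a : posint) : posint := mkpos (val a).
Definition posD (a b : posint) : posint :=
  exist (fun n => 0 < n)%N (val a + val b)%N (ltn_addr (val b) (valP a)).

Definition zindex := seq posint.
Definition weight (s : zindex) : nat := \sum_(a <- s) val a.

Notation HH := {malg rat[zindex]}.
Notation HH2 := {malg rat[(zindex * zindex)%type]}.

Definition Hone : HH := << [::] >>.
Definition Hcounit (u : HH) : rat := u@_[::].
Definition Hhomog (n : nat) (u : HH) : Prop :=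
  forall s, s \in msupp u -> weight s = n.

(* Words in x_0 and x_1: x_0 is false, x_1 is true. *)

Definition word := seq bool.

Definition wcons (a : bool) : {malg rat[word]} -> {malg rat[word]} :=
  lext (fun w => << a :: w >>).

Fixpoint shuffle_word (w1 : word) : word -> {malg rat[word]} :=
  match w1 with
  | [::] => fun w2 => << w2 >>
  | a :: w1' =>
    fix aux (w2 : word) : {malg rat[word]} :=
      match w2 with
      | [::] => << w1 >>
      | b :: w2' => wcons a (shuffle_word w1' w2) + wcons b (aux w2')
      end
  end.

Definition shuffle (u v : {malg rat[word]}) : {malg rat[word]} :=
  lext (fun w1 => lext (fun w2 => shuffle_word w1 w2) v) u.

Definition rho_word (s : zindex) : word :=
  flatten [seq rcons (nseq (val a).-1 false) true | a <- s].

Definition rho : HH -> {malg rat[word]} := lext (fun s => << rho_word s >>).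

HB.instance Definition _ := GRing.Linear.on rho.

(* Inverse of rho_word; n counts the letters x_0 read since the last x_1.
   Words that are neither empty nor ending in x_1 are outside the image of
   rho, and the value there (trailing letters x_0 are dropped) is irrelevant,
   see rho_shuffleH. *)
Fixpoint unrho_word (n : nat) (w : word) : zindex :=
  match w with
  | [::] => [::]
  | false :: w' => unrho_word n.+1 w'
  | true :: w' => mkpos n :: unrho_word 0 w'
  end.

Definition unrho : {malg rat[word]} -> HH := lext (fun w => << unrho_word 0 w >>).

HB.instance Definition _ := GRing.Linear.on unrho.

Definition shuffleH (u v : HH) : HH := unrho (shuffle (rho u) (rho v)).

Definition lcons (a : posint) : HH -> HH := lext (fun s => << a :: s >>).

Fixpoint qshuffle_index (s : zindex) : zindex -> HH :=
  match s with
  | [::] => fun t => << t >>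
  | a :: s' =>
    fix aux (t : zindex) : HH :=
      match t with
      | [::] => << s >>
      | b :: t' => lcons a (qshuffle_index s' t) + lcons b (aux t')
                   + lcons (posD a b) (qshuffle_index s' t')
      end
  end.

Definition qshuffleH (u v : HH) : HH :=
  lext (fun s => lext (fun t => qshuffle_index s t) v) u.

Definition Ddec : HH -> HH2 :=
  lext (fun s => \sum_(i < (size s).+1) << (take i s, drop i s) >>).

(* The entries s_1, ..., s_k are at the positions 0, ..., k-1. *)
Definition raise (j : nat) (s : zindex) : zindex :=
  set_nth pos1 s j (posS (nth pos1 s j)).

Definition delta_index (i : nat) (s : zindex) : HH :=
  if (i <= size s)%N
  then \sum_(j < i) (val (nth pos1 s j))%:R *: << raise j s >>
  else 0.

Definition delta (i : nat) : HH -> HH := lext (delta_index i).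

HB.instance Definition _ i := GRing.Linear.on (delta i).

(* For i <= dep s the truncated difference is 0, and delta 0 = 0. *)
Definition id_circS_delta (i : nat) : HH2 -> HH2 :=
  lext (fun p => tens << p.1 >> (delta (i - size p.1) << p.2 >>)).

HB.instance Definition _ i := GRing.Linear.on (id_circS_delta i).

Definition ones (k : nat) : zindex := nseq k pos1.

Record is_Delta_ge1 (D : HH -> HH2) : Prop := IsDeltaGe1 {
  Delta_linear : linear D;
  Delta_one : D Hone = tens Hone Hone;
  Delta_ones : forall k,
    D << ones k >> = \sum_(j < k.+1) tens << ones j >> << ones (k - j) >>;
  Delta_delta : forall i, (0 < i)%N -> forall u,
    id_circS_delta i (D u) + tmap (delta i) id (D u) = D (delta i u)
}.

Record character (chi : HH -> rat) : Prop := Character {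
  char_linear : linear_for *%R chi;
  char_one : chi Hone = 1;
  char_mul : forall u v, chi (shuffleH u v) = chi u * chi v
}.

Record graded_hopf_hom (m1 : HH -> HH -> HH) (D1 : HH -> HH2)
    (m2 : HH -> HH -> HH) (D2 : HH -> HH2) (f : HH -> HH) : Prop :=
  GradedHopfHom {
    hom_linear : linear f;
    hom_one : f Hone = Hone;
    hom_mul : forall u v, f (m1 u v) = m2 (f u) (f v);
    hom_counit : forall u, Hcounit (f u) = Hcounit u;
    hom_comul : forall u, tmap f f (D1 u) = D2 (f u);
    hom_graded : forall n u, Hhomog n u -> Hhomog n (f u)
  }.

Definition graded_hopf_iso m1 D1 m2 D2 (f : HH -> HH) : Prop :=
  graded_hopf_hom m1 D1 m2 D2 f /\
  exists g, [/\ graded_hopf_hom m2 D2 m1 D1 g, cancel f g & cancel g f].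

Definition chiQ (u : HH) : rat :=
  \sum_(s <- msupp u | (size s <= 1)%N) u@_s.

(* Psi_chi is defined by its universal property, D standing for Delta_{>=1}.
   If no such homomorphism existed, the value would be the zero map, which is
   not a homomorphism of unital algebras. *)
Definition Psi (D : HH -> HH2) (chi : HH -> rat) : HH -> HH :=
  xget (fun=> 0)
    [set f | graded_hopf_hom shuffleH D qshuffleH Ddec f /\ chiQ \o f = chi].

(* The product shuffleH is the pullback of the shuffle product along rho. *)

Lemma rho_wordK : cancel rho_word (unrho_word 0).
Proof.
elim=> [//|[[//|n] a_gt0] s IHs]; rewrite /rho_word /= -/(rho_word s).
suff H m w : unrho_word m (rcons (nseq n false) true ++ w)
             = mkpos (m + n) :: unrho_word 0 w.
  by rewrite H IHs; congr (_ :: _); apply: val_inj.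
by elim: n {a_gt0} m => [|n IHn] m /=; rewrite ?addn0 // IHn addnS.
Qed.

Definition admissible (w : word) := last true w.

Lemma unrho_wordK w : admissible w -> rho_word (unrho_word 0 w) = w.
Proof.
suff H n : admissible w -> rho_word (unrho_word n w)
           = if w is [::] then [::] else nseq n false ++ w.
  by case: w H => [//|b w] H /H ->.
elim: w n => [//|[] w IHw] n lw /=.
  by rewrite /rho_word /= -/(rho_word _) cat_rcons IHw //; case: (w).
case: w lw IHw => [//|b w] lw IHw.
by rewrite IHw // -[nseq n.+1 _]/(nseq (1 + n) _) addnC nseqD -catA.
Qed.

Lemma rho_unrho (u : {malg rat[word]}) :
  (forall w, w \in msupp u -> admissible w) -> rho (unrho u) = u.
Proof.
move=> au; rewrite [in RHS](monalgE u) /unrho [lext _ u]/lext linear_sum /=.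
apply: eq_big_seq => w wu; rewrite linearZ /= /rho lextU unrho_wordK ?au //.
by apply/malgP => x; rewrite mcoeffZ !mcoeffU mulrnAr mulr1.
Qed.

Definition lastin (c : bool) (u : {malg rat[word]}) :=
  forall w, w \in msupp u -> last c w.

Lemma lastinD c u v : lastin c u -> lastin c v -> lastin c (u + v).
Proof.
move=> cu cv w /(fsubsetP (msuppD_le _ _)); rewrite in_fsetU.
by case/orP; [apply: cu | apply: cv].
Qed.

Lemma lastin_lext (K : choiceType) c (f : K -> {malg rat[word]}) u :
  (forall k, k \in msupp u -> lastin c (f k)) -> lastin c (lext f u).
Proof.
move=> cf; rewrite /lext; rewrite big_seq.
apply: big_ind => [w||k ku w]; [by rewrite msupp0 | exact: lastinD |].
move/(fsubsetP (msuppZ_le _ _)); exact: cf ku w.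
Qed.

Lemma lastin_wcons c a u : lastin a u -> lastin c (wcons a u).
Proof.
move=> au; apply: lastin_lext => w wu x.
by rewrite msuppU oner_eq0 in_fset1 => /eqP -> /=; apply: au.
Qed.

Lemma lastin_shuffle_word (c1 c2 : bool) (w1 w2 : word) :
  last c1 w1 -> last c2 w2 -> lastin (c1 && c2) (shuffle_word w1 w2).
Proof.
have lastinU (c : bool) (w : word) : last c w -> lastin c << w >>.
  by move=> cw x; rewrite msuppU oner_eq0 in_fset1 => /eqP ->.
elim: w1 c1 c2 w2 => [|a w1 IH1] c1 c2 w2 /=.
  by move=> -> l2; apply: lastinU.
elim: w2 c1 c2 => [|b w2 IH2] c1 c2 l1 l2.
  exact: lastinU.
apply: lastinD; apply: lastin_wcons.
  by rewrite -[a]andbT; apply: IH1.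
exact: (IH2 true b).
Qed.

Lemma rho_shuffleH u v : rho (shuffleH u v) = shuffle (rho u) (rho v).
Proof.
apply: rho_unrho; have adm_rho x : lastin true (rho x).
  apply: lastin_lext => s _ w; rewrite msuppU oner_eq0 in_fset1 => /eqP -> {x w}.
  by elim: s => [//|a s IHs]; rewrite /rho_word /= last_cat last_rcons.
apply: lastin_lext => w1 w1u; apply: lastin_lext => w2 w2v.
by apply: (@lastin_shuffle_word true true); [apply: adm_rho w1u | apply: adm_rho w2v].
Qed.

(* The map Delta_{>=1} exists: with D_i := id (S) delta_i + delta_i (x) id and
   the pairwise commuting operators G_l := D_(l+1) - D_l, it is given by
   [s_1, ..., s_k] |-> prod_l G_(l-1)^(s_l - 1) / (s_l - 1)! applied to the
   prescribed image of [1_k]. *)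

Lemma size_raise j s : (j < size s)%N -> size (raise j s) = size s.
Proof. by move=> js; rewrite size_set_nth; apply/maxn_idPr. Qed.

Section Build.
Variables (V : lmodType rat) (T : nat -> {linear V -> V}).
Hypothesis TC : forall i j x, T i (T j x) = T j (T i x).
Hypothesis T0 : forall x, T 0 x = 0.

Let G l : V -> V := T l.+1 \- T l.

HB.instance Definition _ l := GRing.Linear.on (G l).

Let GE l x : G l x = T l.+1 x - T l x. Proof. by []. Qed.

Let TG i l x : T i (G l x) = G l (T i x).
Proof. by rewrite !GE linearB !(TC i). Qed.

Let GC l m x : G l (G m x) = G m (G l x).
Proof. by rewrite !(GE l) !TG -linearB. Qed.

Let sumG i x : T i x = \sum_(l < i) G l x.
Proof.
elim: i => [|i IHi]; first by rewrite big_ord0 T0.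
by rewrite big_ord_recr /= -IHi GE addrC subrK.
Qed.

Let iterGC (f : V -> V) l n x :
  (forall y, f (G l y) = G l (f y)) -> f (iter n (G l) x) = iter n (G l) (f x).
Proof. by move=> fG; elim: n => //= n IHn; rewrite fG IHn. Qed.

Let iterGZ l n c x : iter n (G l) (c *: x) = c *: iter n (G l) x.
Proof. by elim: n => //= n ->; rewrite linearZ. Qed.

Fixpoint build (l : nat) (s : zindex) (v : V) : V :=
  match s with
  | [::] => v
  | a :: s' => (((val a).-1)`!%:R)^-1 *: iter (val a).-1 (G l) (build l.+1 s' v)
  end.

Let G_build l j s v : (j < size s)%N ->
  G (l + j) (build l s v) = (val (nth pos1 s j))%:R *: build l (raise j s) v.
Proof.
elim: s l j => [//|a s IHs] l [_|j] /=.
  rewrite addn0 linearZ /= scalerA; case: a => -[//|n] a_gt0 /=.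
  congr (_ *: _); rewrite factS natrM invfM mulrA divff ?mul1r //.
  by rewrite Num.Theory.pnatr_eq0.
rewrite ltnS => js; rewrite linearZ /= iterGC; last by move=> y; rewrite GC.
by rewrite addnS -addSn IHs // iterGZ !scalerA mulrC.
Qed.

Lemma op_build i s v : (i <= size s)%N -> T i (build 0 s v) =
  \sum_(j < i) (val (nth pos1 s j))%:R *: build 0 (raise j s) v.
Proof.
move=> is_; rewrite sumG; apply: eq_bigr => l _.
by rewrite -G_build ?(leq_trans (ltn_ord l)).
Qed.

Lemma op_build_eq0 i l s v : T i v = 0 -> T i (build l s v) = 0.
Proof.
move=> v0; elim: s l => [//|a s IHs] l /=; rewrite linearZ /= iterGC ?IHs //.
  by rewrite -(scale0r (0 : V)) iterGZ !scale0r scaler0.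
Qed.

Lemma build_ones l k v : build l (ones k) v = v.
Proof. by elim: k l => //= k IHk l; rewrite IHk fact0 invr1 scale1r. Qed.

End Build.

Section DeltaExists.

Let Dop (i : nat) (x : HH2) : HH2 :=
  id_circS_delta i x + tmap (delta i) id x.

Let Dop_linear i : linear (Dop i).
Proof.
move=> a x y; rewrite /Dop !linearP scalerDr addrACA.
by [].
Qed.

HB.instance Definition _ i :=
  GRing.isLinear.Build rat HH2 HH2 _ (Dop i) (Dop_linear i).

Let deltaU i s : delta i << s >> = delta_index i s.
Proof. exact: lextU. Qed.

Let DopU i s t : Dop i << (s, t) >> =
  tens << s >> (delta (i - size s) << t >>) + tens (delta i << s >>) << t >>.
Proof.
rewrite /Dop; congr (_ + _).
  exact: (lextU (fun p : zindex * zindex =>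
    tens << p.1 >> (delta (i - size p.1) << p.2 >>))).
exact: (lextU (fun p : zindex * zindex => tens (delta i << p.1 >>) << p.2 >>)).
Qed.

Let delta0 u : delta 0 u = 0.
Proof.
rewrite /delta /lext big1 // => s _.
by rewrite /delta_index /= big_ord0 scaler0.
Qed.

Let delta_big i s : (size s < i)%N -> delta i << s >> = 0.
Proof. by move=> si; rewrite deltaU /delta_index leqNgt si. Qed.

Let raiseC a b s : raise a (raise b s) = raise b (raise a s).
Proof.
have [->//|ab] := eqVneq a b.
have ba : b != a by rewrite eq_sym.
by rewrite /raise !nth_set_nth /= ifN // ifN // set_set_nth ifN.
Qed.

Let deltaC i j s : delta i (delta j << s >>) = delta j (delta i << s >>).
Proof.
have zero i' j' : (size s < i')%N -> delta i' (delta j' << s >>) = 0.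
  move=> si; rewrite deltaU /delta_index; case: leqP => [js|_]; last exact: linear0.
  rewrite linear_sum big1 // => k _; rewrite linearZ /= delta_big ?scaler0 //.
  by rewrite size_raise // (leq_trans (ltn_ord k)).
have [is_|si] := leqP i (size s); last by rewrite zero // (delta_big si) linear0.
have [js|sj] := leqP j (size s); last by rewrite [RHS]zero // (delta_big sj) linear0.
have dd i' j' : (i' <= size s)%N -> (j' <= size s)%N ->
  delta i' (delta j' << s >>) = \sum_(b < j') \sum_(a < i')
    ((val (nth pos1 s b))%:R * (val (nth pos1 (raise b s) a))%:R)
      *: << raise a (raise b s) >>.
  move=> i's j's; rewrite deltaU /delta_index j's linear_sum; apply: eq_bigr => b _.
  have bs := leq_trans (ltn_ord b) j's.
  rewrite linearZ /= deltaU /delta_index size_raise // i's scaler_sumr.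
  by apply: eq_bigr => a _; rewrite scalerA.
rewrite !dd // exchange_big; apply: eq_bigr => a _; apply: eq_bigr => b _.
rewrite raiseC; congr (_ *: _); have [-> //|ab] := eqVneq (a : nat) b.
have ba : b != a :> nat by rewrite eq_sym.
by rewrite /raise !nth_set_nth /= ifN // ifN // mulrC.
Qed.

Let tens0l (v : HH) : tens (0 : HH) v = 0.
Proof. exact: (linear0 (tensr v)). Qed.

Let tensZl a (u v : HH) : tens (a *: u) v = a *: tens u v.
Proof. exact: (linearZ_LR (tensr v)). Qed.

Let tens_suml n (F : 'I_n -> HH) (v : HH) :
  tens (\sum_(j < n) F j) v = \sum_(j < n) tens (F j) v.
Proof. exact: (linear_sum (tensr v)). Qed.

Let Dop_tensl i j s t : Dop i (tens (delta j << s >>) << t >>) =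
  tens (delta j << s >>) (delta (i - size s) << t >>)
  + tens (delta i (delta j << s >>)) << t >>.
Proof.
rewrite deltaU /delta_index; case: leqP => [js|_]; last first.
  by rewrite linear0 !tens0l linear0 addr0.
rewrite [delta i _]linear_sum !tens_suml [Dop i _]linear_sum -big_split /=; apply: eq_bigr => k _.
rewrite linearZ !tensZl linearZ /= tensUU DopU scalerDr size_raise //.
exact: leq_trans (ltn_ord k) js.
Qed.

Let Dop_tensr i s v : Dop i (tens << s >> v) =
  tens << s >> (delta (i - size s) v) + tens (delta i << s >>) v.
Proof.
pose L : HH -> HH2 := Dop i \o tens << s >>.
pose R : HH -> HH2 := tens << s >> \o delta (i - size s) \+ tens (delta i << s >>).
apply: (@malg_linear_eq _ _ L R) => t.
by rewrite /L /R /= tensUU DopU.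
Qed.

Let DopDopU i j s t : Dop i (Dop j << (s, t) >>) =
  (tens << s >> (delta (i - size s) (delta (j - size s) << t >>))
   + tens (delta i << s >>) (delta (j - size s) << t >>))
  + (tens (delta j << s >>) (delta (i - size s) << t >>)
     + tens (delta i (delta j << s >>)) << t >>).
Proof.
rewrite DopU; apply: etrans (linearD (Dop i) _ _) _.
by congr (_ + _); [exact: Dop_tensr | exact: Dop_tensl].
Qed.

Let DopC i j x : Dop i (Dop j x) = Dop j (Dop i x).
Proof.
apply: (@malg_linear_eq _ _ (Dop i \o Dop j) (Dop j \o Dop i)) => -[s t].
apply: etrans (DopDopU i j s t) _; apply: esym.
apply: etrans (DopDopU j i s t) _.
rewrite [delta (j - size s) _](deltaC (j - size s) (i - size s) t).
by rewrite [delta j (delta i _)](deltaC j i s); exact: addrACA.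
Qed.

Let base k : HH2 := \sum_(j < k.+1) tens << ones j >> << ones (k - j) >>.

Let Dop_base i k : (k < i)%N -> Dop i (base k) = 0.
Proof.
move=> ki; apply: etrans (linear_sum (Dop i) _ _ _) _; apply: big1 => j _.
have jk : (j <= k)%N by rewrite -ltnS.
rewrite tensUU; apply: etrans (DopU _ _ _) _.
rewrite size_nseq delta_big ?size_nseq; last first.
  by rewrite ltn_sub2r // (leq_ltn_trans jk ki).
rewrite delta_big ?size_nseq ?(leq_ltn_trans jk ki) //.
by rewrite tens0l linear0 addr0.
Qed.

Let Dop0 x : Dop 0 x = 0.
Proof.
apply: (@malg_linear_eq _ _ (Dop 0) (\0 : {linear HH2 -> HH2})) => -[s t] /=.
by rewrite DopU sub0n !delta0 tens0l linear0 addr0.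
Qed.

Lemma Delta_ge1_exists : exists D, is_Delta_ge1 D.
Proof.
pose B s := build (fun i => Dop i : {linear HH2 -> HH2}) 0 s (base (size s)).
have BU s : lext B << s >> = B s by exact: lextU.
have Bones k : lext B << ones k >> = base k.
  by rewrite BU /B build_ones size_nseq.
exists (lext B); split=> [| | |i _ u]; first exact: lext_is_linear.
- by rewrite -[Hone]/(<< ones 0 >>) Bones /base big_ord1.
- exact: Bones.
rewrite -/(Dop i (lext B u)).
apply: (@malg_linear_eq _ _ (Dop i \o lext B) (lext B \o delta i)) => s.
rewrite [LHS]/= [RHS]/= BU deltaU /delta_index; case: leqP => [is_|si].
  rewrite linear_sum /B; apply: etrans (op_build DopC Dop0 _ is_) _.
  apply: eq_bigr => j _; rewrite linearZ /= BU /B size_raise //.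
  exact: leq_trans (ltn_ord j) is_.
rewrite linear0; apply: (op_build_eq0 DopC); exact: Dop_base.
Qed.

End DeltaExists.

(* Main.v *)
Require Import Defs.
From HB Require Import structures.
From mathcomp Require Import all_boot all_order all_algebra.
From mathcomp Require Import finmap monalg.
From mathcomp Require Import boolp classical_sets functions.

Set Implicit Arguments.
Unset Strict Implicit.
Unset Printing Implicit Defensive.

Import GRing.Theory.
Local Open Scope ring_scope.

(** The Hopf algebra of shuffles with Delta_{>=1} is an ordinary shuffle Hopf
    algebra seen in an unusual basis, and in the right basis everything becomes
    combinatorics of words.

    For an index s = [s_1, ..., s_k] put
      dpow s = prod_l delta_l^(s_l - 1) / (s_l - 1)! applied to [1_k].
    With F_k(z_1, ..., z_k) = exp (sum_l z_l delta_l) [1_k] as generating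
    series, the compatibility of Delta_{>=1} with the delta_i says that
    Delta_{>=1} F_k(z) = sum_j F_j(z_1, ..., z_j) (x) F_{k-j}(z_{j+1}, ..., z_k),
    while the words W_k = rho F_k satisfy
      W_k(z) = (z_1 + ... + z_k) x_0 W_k(z) + x_1 W_{k-1}(z_2, ..., z_k),
    so that W_j(z) times W_m(w) is the sum of W_{j+m} over the shuffles of z
    and w.  On coefficients: Delta_{>=1} deconcatenates the index of dpow s
    (Delta_dpow), and shuffleH (dpow s) (dpow t) is the sum of dpow over the
    letterwise shuffles of s and t (shuffleH_dpow).  The recursion for W_k is
    taken as the definition of dpow, and delta_dpow recovers the divided powers.
    As dpow s is [s] plus terms with smaller moment, it is a basis.

    Let f be a homomorphism and c s = chiQ (f (dpow s)).  Cutting off the first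
    letter of Ddec (f (dpow s)) shows that f (dpow s) is the sum, over all ways
    to cut s into nonempty blocks p_1, ..., p_m, of
    c p_1 ... c p_m [weight p_1, ..., weight p_m] (hom_dpow).  Hence f is
    determined by chiQ o f.  Conversely this sum, called char_hom c s, defines a
    homomorphism as soon as c comes from a character: comultiplicativity is the
    coassociativity of cutting (Ddec_char_hom), and multiplicativity is the
    compatibility of cutting with shuffling (shuffle_sum_cut_sum), the stuffed
    terms of the quasi-shuffle accounting for first blocks that take letters
    from both factors (char_hom_mul).

    Finally char_hom c s is (c [s_1] ... c [s_k]) [s] plus terms of smaller
    depth, and c [a] = chi [a].  If no chi [a] vanishes, the homomorphism is
    triangular with invertible diagonal, hence bijective; if some chi [a] is
    zero, the homomorphism kills [a]. *)

(** * Sums over shuffles and over cuts of a word *)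

(** Keeping g as an argument avoids forming the shuffle product of words: identities
    in the shuffle algebra become identities between sums with varying g.  Shuffles
    are counted with multiplicity. *)
Fixpoint shuffle_sum (A : Type) (V : nmodType) (s : seq A) : seq A -> (seq A -> V) -> V :=
  match s with
  | [::] => fun t g => g t
  | a :: s' =>
    fix aux t g :=
      match t with
      | [::] => g s
      | b :: t' => shuffle_sum s' t (fun w => g (a :: w)) + aux t' (fun w => g (b :: w))
      end
  end.

Arguments shuffle_sum : simpl never.

(** The deconcatenation coproduct in the same functional form. *)
Fixpoint cut_sum (A : Type) (V : nmodType) (s : seq A) (h : seq A -> seq A -> V) : V :=
  match s with
  | [::] => h [::] [::]
  | a :: s' => h [::] s + cut_sum s' (fun p q => h (a :: p) q)
  end.

Section ShuffleCut.
Variable A : eqType.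
Implicit Types (s t w p q : seq A) (a b : A).

Section Values.
Variable V : nmodType.
Implicit Types (g : seq A -> V) (h : seq A -> seq A -> V).

Lemma shuffle_sum_nilr s g : shuffle_sum s [::] g = g s.
Proof. by case: s. Qed.

Lemma shuffle_sum_cons a s b t g :
  shuffle_sum (a :: s) (b :: t) g =
  shuffle_sum s (b :: t) (fun w => g (a :: w)) + shuffle_sum (a :: s) t (fun w => g (b :: w)).
Proof. by []. Qed.

(** Shuffles of s and t are rearrangements of s ++ t, so g matters only there. *)
Lemma eq_shuffle_sum_perm s t g g' :
  (forall w, perm_eq w (s ++ t) -> g w = g' w) -> shuffle_sum s t g = shuffle_sum s t g'.
Proof.
elim: s t g g' => [|a s IHs] t g g' gg' /=; first exact: gg'.
elim: t g g' gg' => [|b t IHt] g g' gg' /=; first by apply: gg'; rewrite cats0.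
congr (_ + _); first by apply: IHs => w ws; apply: gg'; rewrite perm_cons.
apply: IHt => w ws; apply: gg'.
by rewrite perm_sym (perm_catCA (a :: s) [:: b] t) perm_cons perm_sym.
Qed.

Lemma eq_shuffle_sum s t g g' : (forall w, g w = g' w) -> shuffle_sum s t g = shuffle_sum s t g'.
Proof. by move=> gg'; apply: eq_shuffle_sum_perm => w _. Qed.

Lemma shuffle_sumD s t g g' :
  shuffle_sum s t (fun w => g w + g' w) = shuffle_sum s t g + shuffle_sum s t g'.
Proof.
elim: s t g g' => [|a s IHs] // t; elim: t => [|b t IHt] // g g'.
by rewrite !shuffle_sum_cons IHs IHt addrACA.
Qed.

Lemma eq_cut_sum_cat s h h' :
  (forall p q, p ++ q = s -> h p q = h' p q) -> cut_sum s h = cut_sum s h'.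
Proof.
elim: s h h' => [|a s IHs] h h' hh' /=; first exact: hh'.
by rewrite hh' //; congr (_ + _); apply: IHs => p q pq; apply: hh'; rewrite /= pq.
Qed.

Lemma eq_cut_sum s h h' : (forall p q, h p q = h' p q) -> cut_sum s h = cut_sum s h'.
Proof. by move=> hh'; apply: eq_cut_sum_cat => p q _. Qed.

Lemma cut_sumD s h h' :
  cut_sum s (fun p q => h p q + h' p q) = cut_sum s h + cut_sum s h'.
Proof. by elim: s h h' => [|a s IHs] //= h h'; rewrite IHs addrACA. Qed.

Lemma cut_sum0 s : cut_sum s (fun _ _ => 0) = 0 :> V.
Proof. by elim: s => [|a s IHs] //=; rewrite IHs addr0. Qed.

Lemma cut_sumE s h : cut_sum s h = \sum_(i < (size s).+1) h (take i s) (drop i s).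
Proof.
elim: s h => [|a s IHs] h /=; first by rewrite big_ord1.
by rewrite IHs [RHS]big_ord_recl; congr (_ + _); apply: eq_bigr => i _.
Qed.

Lemma cut_sum_coassoc s (h : seq A -> seq A -> seq A -> V) :
  cut_sum s (fun p q => cut_sum q (h p)) =
  cut_sum s (fun r q => cut_sum r (fun p p' => h p p' q)).
Proof.
elim: s h => [|a s IHs] h //=.
by rewrite IHs cut_sumD addrA.
Qed.

(** Deconcatenation is multiplicative for the shuffle product: to cut a shuffle
    is to cut both words and shuffle the left parts and the right parts. *)
Lemma shuffle_sum_cut_sum s t h :
  shuffle_sum s t (fun w => cut_sum w h) =
  cut_sum s (fun p q => cut_sum t (fun p' q' =>
    shuffle_sum p p' (fun u => shuffle_sum q q' (h u)))).
Proof.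
elim: s t h => [|a s IHs] // t; elim: t => [|b t IHt] h.
  rewrite shuffle_sum_nilr /=; congr (_ + _); apply: eq_cut_sum => p q.
  by rewrite /= !shuffle_sum_nilr.
rewrite [LHS]shuffle_sum_cons [in LHS]/= [in X in X + _]shuffle_sumD [in X in _ + X]shuffle_sumD.
rewrite IHs {}IHt addrACA -[in LHS]shuffle_sum_cons [RHS]/= -[RHS]addrA; congr (_ + _).
under [X in X + _ = _]eq_cut_sum => p q do rewrite /= shuffle_sum_nilr.
under [X in _ = _ + X]eq_cut_sum => p q.
  rewrite /= shuffle_sum_nilr; under [X in _ + X]eq_cut_sum => p' q' do rewrite shuffle_sum_cons.
  rewrite cut_sumD; over.
by rewrite [cut_sum (a :: s) _]/= !cut_sumD [LHS]addrCA !addrA.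
Qed.

End Values.

Section Additive.
Variables (U V : nmodType) (f : {additive U -> V}).

Lemma raddf_shuffle_sum s t (g : seq A -> U) :
  f (shuffle_sum s t g) = shuffle_sum s t (fun w => f (g w)).
Proof.
elim: s t g => [|a s IHs] // t; elim: t => [|b t IHt] // g.
by rewrite !shuffle_sum_cons raddfD /= IHs IHt.
Qed.

Lemma raddf_cut_sum s (h : seq A -> seq A -> U) :
  f (cut_sum s h) = cut_sum s (fun p q => f (h p q)).
Proof. by elim: s h => [|a s IHs] h //=; rewrite raddfD /= IHs. Qed.

End Additive.

End ShuffleCut.

(** * Lowering an entry and removing a leading 1 *)

Lemma weight_nil : weight [::] = 0%N.
Proof. exact: big_nil. Qed.

Lemma weight_cons a s : weight (a :: s) = (val a + weight s)%N.
Proof. exact: big_cons. Qed.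

Lemma weight_cat s t : weight (s ++ t) = (weight s + weight t)%N.
Proof. exact: big_cat. Qed.

Lemma weight_perm s t : perm_eq s t -> weight s = weight t.
Proof. by move=> st; apply: perm_big. Qed.

Lemma weight_eq0 s : (weight s == 0%N) = (s == [::]).
Proof.
case: s => [|[[//|a] a_gt0] s]; first by rewrite weight_nil eqxx.
by rewrite weight_cons.
Qed.

Definition posPred (a : posint) : posint := mkpos (val a).-2.

Lemma val_posPred (a : posint) : (1 < val a)%N -> (val (posPred a)).+1 = val a.
Proof. by case: a => [[|[|n]] a_gt0]. Qed.

Lemma posSK : cancel posS posPred.
Proof. by case=> [[//|n] n_gt0]; apply: val_inj. Qed.

Lemma posPredK (a : posint) : (1 < val a)%N -> posS (posPred a) = a.
Proof. by case: a => [[|[|n]] a_gt0] //= _; apply: val_inj. Qed.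

Lemma posint_eq1 (a : posint) : (val a == 1)%N -> a = pos1.
Proof. by move/eqP=> a1; apply: val_inj. Qed.

(** The derivation of weight -1 that is dual, on dpow, to prefixing a word with x_0. *)
Fixpoint lower_sum (V : nmodType) (g : zindex -> V) (s : zindex) : V :=
  match s with
  | [::] => 0
  | a :: s' => (if (1 < val a)%N then g (posPred a :: s') else 0)
               + lower_sum (fun w => g (a :: w)) s'
  end.

Arguments lower_sum : simpl never.

(** Dual, on dpow, to prefixing a word with x_1. *)
Definition chop_sum (V : nmodType) (g : zindex -> V) (s : zindex) : V :=
  if s is a :: s' then if (val a == 1)%N then g s' else 0 else 0.

Section LowerChop.
Variable V : nmodType.
Implicit Types (g : zindex -> V) (s t : zindex).

Lemma lower_sum_cons a s g : lower_sum g (a :: s) =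
  (if (1 < val a)%N then g (posPred a :: s) else 0) + lower_sum (fun w => g (a :: w)) s.
Proof. by []. Qed.

Lemma eq_lower_sum s g g' :
  (forall w, size w = size s -> (weight w).+1 = weight s -> g w = g' w) ->
  lower_sum g s = lower_sum g' s.
Proof.
elim: s g g' => [|a s IHs] g g' gg' //; rewrite !lower_sum_cons; congr (_ + _).
  by case: ifP => // a1; apply: gg'; rewrite // !weight_cons -addSn val_posPred.
apply: IHs => w ws wts; apply: gg'; first by rewrite /= ws.
by rewrite !weight_cons -addnS wts.
Qed.

Lemma eq_chop_sum s g g' :
  (forall w, (size w).+1 = size s -> (weight w).+1 = weight s -> g w = g' w) ->
  chop_sum g s = chop_sum g' s.
Proof.
case: s => [|a s] // gg'; rewrite /chop_sum; case: eqP => // a1.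
by apply: gg' => //; rewrite weight_cons a1.
Qed.

Lemma lower_sumD s g g' :
  lower_sum (fun w => g w + g' w) s = lower_sum g s + lower_sum g' s.
Proof.
elim: s g g' => [|a s IHs] g g'; first by rewrite addr0.
by rewrite !lower_sum_cons IHs addrACA; case: ifP; rewrite ?addr0.
Qed.

Lemma shuffle_sum0 s t : shuffle_sum s t (fun _ => 0) = 0 :> V.
Proof.
elim: s t => [|a s IHs] // t; elim: t => [|b t IHt] //.
by rewrite shuffle_sum_cons IHs IHt addr0.
Qed.

(** Lowering an entry is a derivation of the concatenation algebra that maps
    letters to letters, hence a derivation of the shuffle algebra as well. *)
Lemma lower_shuffle_sum s t g :
  shuffle_sum s t (lower_sum g) =
  lower_sum (fun s' => shuffle_sum s' t g) s + lower_sum (fun t' => shuffle_sum s t' g) t.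
Proof.
elim: s t g => [|a s IHs] t; first by move=> g; rewrite add0r.
elim: t => [|b t IHt] g.
  rewrite shuffle_sum_nilr addr0.
  by apply: eq_lower_sum => w _ _; rewrite shuffle_sum_nilr.
pose low (c : posint) w := if (1 < val c)%N then g (posPred c :: w) else 0.
have lowE c w : lower_sum g (c :: w) = low c w + lower_sum (fun u => g (c :: u)) w by [].
rewrite shuffle_sum_cons.
rewrite [X in X + _](eq_shuffle_sum _ _ (lowE a)) [X in _ + X](eq_shuffle_sum _ _ (lowE b)).
rewrite !shuffle_sumD IHs {}IHt !lower_sum_cons.
have -> : (if (1 < val a)%N then shuffle_sum (posPred a :: s) (b :: t) g else 0)
    = shuffle_sum s (b :: t) (low a)
      + (if (1 < val a)%N then shuffle_sum (posPred a :: s) t (fun u => g (b :: u)) else 0).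
  by rewrite /low; case: ifP; rewrite ?shuffle_sum0 ?addr0.
have -> : (if (1 < val b)%N then shuffle_sum (a :: s) (posPred b :: t) g else 0)
    = (if (1 < val b)%N then shuffle_sum s (posPred b :: t) (fun u => g (a :: u)) else 0)
      + shuffle_sum (a :: s) t (low b).
  by rewrite /low; case: ifP; rewrite ?shuffle_sum0 ?addr0.
have -> : lower_sum (fun w => shuffle_sum (a :: w) (b :: t) g) s
    = lower_sum (fun w => shuffle_sum w (b :: t) (fun u => g (a :: u))) s
      + lower_sum (fun w => shuffle_sum (a :: w) t (fun u => g (b :: u))) s.
  by rewrite -lower_sumD.
have -> : lower_sum (fun w => shuffle_sum (a :: s) (b :: w) g) t
    = lower_sum (fun w => shuffle_sum s (b :: w) (fun u => g (a :: u))) t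
      + lower_sum (fun w => shuffle_sum (a :: s) w (fun u => g (b :: u))) t.
  by rewrite -lower_sumD.
by rewrite [LHS](AC ((1*(1*2))*(1*(2*1))) (((1*6)*(2*7))*((3*5)*(4*8)))).
Qed.

(** The first letter of a shuffle comes from one of the two factors, so its
    removal is a derivation. *)
Lemma chop_shuffle_sum s t g :
  shuffle_sum s t (chop_sum g) =
  chop_sum (fun s' => shuffle_sum s' t g) s + chop_sum (fun t' => shuffle_sum s t' g) t.
Proof.
case: s => [|a s]; first by rewrite /= add0r.
case: t => [|b t].
  by rewrite shuffle_sum_nilr /= addr0; case: ifP; rewrite ?shuffle_sum_nilr.
rewrite shuffle_sum_cons /=.
by case: (_ a == _); case: (_ b == _); rewrite ?shuffle_sum0.
Qed.

End LowerChop.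

Section AdditiveLower.
Variables (U V : nmodType) (f : {additive U -> V}).

Lemma raddf_lower_sum s (g : zindex -> U) :
  f (lower_sum g s) = lower_sum (fun w => f (g w)) s.
Proof.
elim: s g => [|a s IHs] g; first exact: raddf0.
by rewrite !lower_sum_cons raddfD /= IHs; case: ifP; rewrite ?raddf0.
Qed.

Lemma raddf_chop_sum s (g : zindex -> U) :
  f (chop_sum g s) = chop_sum (fun w => f (g w)) s.
Proof. by case: s => [|a s] /=; [|case: ifP]; rewrite ?raddf0. Qed.

End AdditiveLower.

(** * Supports and linear extension *)

Section Supports.
Variable K : choiceType.
Implicit Types (P Q : K -> Prop) (u v : {malg rat[K]}).

Definition supp_in P u := forall k, k \in msupp u -> P k.

Lemma supp_in0 P : supp_in P 0.
Proof. by move=> k; rewrite msupp0. Qed.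

Lemma supp_inU P k : P k -> supp_in P << k >>.
Proof. by move=> Pk x; rewrite msuppU oner_eq0 in_fset1 => /eqP ->. Qed.

Lemma supp_inD P u v : supp_in P u -> supp_in P v -> supp_in P (u + v).
Proof.
move=> Pu Pv k /(fsubsetP (msuppD_le _ _)); rewrite in_fsetU.
by case/orP; [apply: Pu | apply: Pv].
Qed.

Lemma supp_inZ P (a : rat) u : supp_in P u -> supp_in P (a *: u).
Proof. by move=> Pu k /(fsubsetP (msuppZ_le _ _)); apply: Pu. Qed.

Lemma supp_inN P u : supp_in P u -> supp_in P (- u).
Proof. by move=> Pu; rewrite -scaleN1r; apply: supp_inZ. Qed.

Lemma sub_supp_in P Q u : (forall k, P k -> Q k) -> supp_in P u -> supp_in Q u.
Proof. by move=> PQ Pu k ku; apply: PQ; apply: Pu. Qed.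

Lemma malgZU (a : rat) k : a *: << k >> = << a *g k >> :> {malg rat[K]}.
Proof. by apply/malgP => x; rewrite mcoeffZ !mcoeffU mulrnAr mulr1. Qed.

Lemma malg_sumE u : u = \sum_(k <- msupp u) u@_k *: << k >>.
Proof. by rewrite {1}(monalgE u); apply: eq_bigr => k _; rewrite malgZU. Qed.

Lemma supp_in_linear_eq (M : lmodType rat) P (f g : {linear {malg rat[K]} -> M}) u :
  (forall k, P k -> f << k >> = g << k >>) -> supp_in P u -> f u = g u.
Proof.
move=> fg Pu; rewrite (malg_sumE u) !linear_sum; apply: eq_big_seq => k ku.
by rewrite !linearZ fg //; apply: Pu.
Qed.

End Supports.

Lemma supp_in_linear (K K' : choiceType) (P : K -> Prop) (Q : K' -> Prop)
    (f : {linear {malg rat[K]} -> {malg rat[K']}}) u :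
  (forall k, P k -> supp_in Q (f << k >>)) -> supp_in P u -> supp_in Q (f u).
Proof.
move=> fQ Pu; rewrite (malg_sumE u) linear_sum big_seq.
apply: big_ind => [||k ku]; [exact: supp_in0 | exact: supp_inD |].
by rewrite linearZ; apply: supp_inZ; apply: fQ; apply: Pu.
Qed.

(** Homomorphisms, characters and coproducts come with linearity as a proposition;
    the theory of linear maps needs it as a structure. *)
Definition linear_of (U V : lmodType rat) (f : U -> V) (fl : linear f) :
  {linear U -> V} := HB.pack f (GRing.isLinear.Build rat U V _ f fl).

Section Bilinear.
Variables (K K' : choiceType) (M : lmodType rat).

Definition lext2 (f : K -> K' -> M) (u : {malg rat[K]}) (v : {malg rat[K']}) : M :=
  lext (fun k => lext (f k) v) u.

Lemma lext2_is_linearl f v : linear (lext2 f ^~ v).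
Proof. by move=> a u u'; rewrite /lext2 linearP. Qed.

Lemma lext2_is_linearr f u : linear (lext2 f u).
Proof.
move=> a v v'; rewrite /lext2 /lext scaler_sumr -big_split /=.
apply: eq_bigr => k _; rewrite -!/(lext _ _) linearP scalerDr !scalerA.
by rewrite [a * _]mulrC.
Qed.

Lemma lext2U f k k' : lext2 f << k >> << k' >> = f k k'.
Proof. by rewrite /lext2 !lextU. Qed.

Lemma bilinear_eq (B B' : {malg rat[K]} -> {malg rat[K']} -> M) u v :
  (forall w, linear (B^~ w)) -> (forall w, linear (B w)) ->
  (forall w, linear (B'^~ w)) -> (forall w, linear (B' w)) ->
  (forall k k', k \in msupp u -> k' \in msupp v ->
     B << k >> << k' >> = B' << k >> << k' >>) ->
  B u v = B' u v.
Proof.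
move=> Bl Br Bl' Br' BB'.
apply: (@supp_in_linear_eq _ _ (fun k => k \in msupp u)
  (linear_of (Bl v)) (linear_of (Bl' v))); last by [].
move=> k ku; apply: (@supp_in_linear_eq _ _ (fun k => k \in msupp v)
  (linear_of (Br _)) (linear_of (Br' _))); last by [].
by move=> k' k'v; apply: BB'.
Qed.

End Bilinear.

Section TensorMaps.
Variables K K' : choiceType.

Lemma tens0l (v : {malg rat[K']}) : tens (0 : {malg rat[K]}) v = 0.
Proof. exact: (linear0 (tensr v)). Qed.

Lemma tensDl (u u' : {malg rat[K]}) (v : {malg rat[K']}) :
  tens (u + u') v = tens u v + tens u' v.
Proof. exact: (linearD (tensr v)). Qed.

Lemma tensZl a (u : {malg rat[K]}) (v : {malg rat[K']}) :
  tens (a *: u) v = a *: tens u v.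
Proof. exact: (linearZ_LR (tensr v)). Qed.

(** A linear map out of a tensor product is a bilinear map; the restriction to
    the supports allows formulas that hold only for homogeneous arguments. *)
Lemma linear_tens_eqE (M : lmodType rat)
    (f : {linear {malg rat[(K * K')%type]} -> M})
    (B : {malg rat[K]} -> {malg rat[K']} -> M) u v :
  (forall w, linear (B^~ w)) -> (forall w, linear (B w)) ->
  (forall k k', k \in msupp u -> k' \in msupp v ->
     f << (k, k') >> = B << k >> << k' >>) ->
  f (tens u v) = B u v.
Proof.
move=> Bl Br fB; apply: (@bilinear_eq _ _ _ (fun u v => f (tens u v)) B) => //.
- by move=> w a x y; rewrite tensDl tensZl linearP.
- by move=> w a x y; rewrite !linearP.
- by move=> k k' ku k'v; rewrite tensUU; apply: fB.
Qed.

Lemma tmap_tens (f : {linear {malg rat[K]} -> {malg rat[K]}})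
    (g : {linear {malg rat[K']} -> {malg rat[K']}}) u v :
  tmap f g (tens u v) = tens (f u) (g v).
Proof.
apply: (@linear_tens_eqE _ (tmap f g) (fun u v => tens (f u) (g v))).
- by move=> w a x y; rewrite linearP tensDl tensZl.
- by move=> w a x y; rewrite !linearP.
- move=> k k' _ _.
  exact: (lextU (fun p : (K * K')%type => tens (f << p.1 >>) (g << p.2 >>))).
Qed.

End TensorMaps.

(** * The divided-power basis *)

HB.instance Definition _ a := GRing.Linear.on (wcons a).
HB.instance Definition _ a := GRing.Linear.on (lcons a).
HB.instance Definition _ := GRing.Linear.on Ddec.

Lemma lconsU a s : lcons a << s >> = << a :: s >>.
Proof. exact: lextU. Qed.

(** Prefixing a word with x_0, read on indices; the empty index is excluded because
    the word x_0 is not admissible. *)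
Definition raise_head : HH -> HH :=
  lext (fun s => if s is a :: s' then << posS a :: s' >> else 0).
HB.instance Definition _ := GRing.Linear.on raise_head.

Lemma raise_headU a s : raise_head << a :: s >> = << posS a :: s >>.
Proof. exact: lextU. Qed.

(** The recursion W_k(z) = (z_1 + ... + z_k) x_0 W_k(z) + x_1 W_{k-1}(z_2, ..., z_k)
    on coefficients.  Both terms lower the weight by exactly 1, so n is the weight. *)
Fixpoint dpow_rec (n : nat) (s : zindex) : HH :=
  if n is n'.+1
  then raise_head (lower_sum (dpow_rec n') s) + lcons pos1 (chop_sum (dpow_rec n') s)
  else Hone.

Definition dpow (s : zindex) : HH := dpow_rec (weight s) s.

Lemma dpow_nil : dpow [::] = Hone.
Proof. by rewrite /dpow weight_nil. Qed.

Lemma dpow_step s : s != [::] ->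
  dpow s = raise_head (lower_sum dpow s) + lcons pos1 (chop_sum dpow s).
Proof.
rewrite -weight_eq0 {1}/dpow; case wE: (weight s) => [//|n] _.
rewrite [LHS]/= (_ : lower_sum _ s = lower_sum dpow s).
  rewrite (_ : chop_sum _ s = chop_sum dpow s) //.
  by apply: eq_chop_sum => w _; rewrite wE => /eq_add_S wn; rewrite /dpow wn.
by apply: eq_lower_sum => w _; rewrite wE => /eq_add_S wn; rewrite /dpow wn.
Qed.

(** The sum of l s_l over the positions l, counted from 0. *)
Fixpoint moment (s : zindex) : nat :=
  if s is a :: s' then (weight s' + moment s')%N else 0%N.

(** Lowering an entry can only lower the moment. *)
Lemma lower_sum_ind (V : nmodType) (P : V -> Prop) (g : zindex -> V) s :
  P 0 -> (forall x y, P x -> P y -> P (x + y)) ->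
  (forall w, size w = size s -> (weight w).+1 = weight s ->
    (moment w <= moment s)%N -> P (g w)) ->
  P (lower_sum g s).
Proof.
move=> P0 PD; elim: s g => [|a s IHs] g Pg //; rewrite lower_sum_cons; apply: PD.
  case: ifP => // a1; apply: Pg => //.
  by rewrite !weight_cons -addSn val_posPred.
apply: IHs => w ws wts wm; apply: Pg; first by rewrite /= ws.
  by rewrite !weight_cons -addnS wts.
by rewrite /= leq_add // -wts.
Qed.

Definition below s w :=
  [/\ size w = size s, weight w = weight s & (moment w < moment s)%N].

Lemma supp_in_tri (P : zindex -> Prop) (s : zindex) (u : HH) :
  P s -> supp_in P (u - << s >>) -> supp_in P u.
Proof. by move=> Ps Pu; rewrite -(subrK << s >> u); apply: supp_inD => //; apply: supp_inU. Qed.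

(** The generating series of dpow arises from that of the symbols [t] by substituting
    z_l + ... + z_k for the l-th variable.  So dpow s involves, besides [s], only
    indices in which some weight has moved to the left. *)
Lemma dpow_triangular s : supp_in (below s) (dpow s - << s >>).
Proof.
have [n] := ubnP (weight s); elim: n s => // n IHn [|a s] sn.
  by rewrite dpow_nil subrr; apply: supp_in0.
have tail w : size w = size s -> (weight w).+1 = weight s ->
    (moment w <= moment s)%N -> supp_in (below (a :: s)) (raise_head (dpow (a :: w))).
  move=> ws wts wm; have wn : (weight (a :: w) < n)%N.
    by move: sn; rewrite !weight_cons -wts addnS.
  apply: (@supp_in_linear _ _ (fun t => [/\ size t = size (a :: w),
    weight t = weight (a :: w) & (moment t <= moment (a :: w))%N])).
    case=> [|b t] [] //; rewrite !weight_cons /= => -[tw] tww twm.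
    rewrite raise_headU; apply: supp_inU; rewrite /below /= tw ws !weight_cons addSn tww.
    split=> //; first by rewrite -addnS wts.
    by apply: leq_ltn_trans twm _; rewrite -wts addSn ltnS leq_add2l.
  apply: supp_in_tri; first by [].
  by apply: sub_supp_in (IHn _ wn) => t [-> -> /ltnW].
have tailS : supp_in (below (a :: s)) (raise_head (lower_sum (fun w => dpow (a :: w)) s)).
  rewrite raddf_lower_sum; apply: lower_sum_ind tail.
  - exact: supp_in0.
  - exact: supp_inD.
rewrite dpow_step // lower_sum_cons linearD /=.
case: ltnP => [a1|a1].
  have an : (weight (posPred a :: s) < n)%N.
    by move: sn; rewrite !weight_cons -[X in (X + _ < _)%N](val_posPred a1).
  rewrite ifN ?linear0 ?addr0; last by rewrite neq_ltn a1 orbT.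
  rewrite addrAC; apply: supp_inD => //.
  have -> : << a :: s >> = raise_head << posPred a :: s >> by rewrite raise_headU posPredK.
  rewrite -linearB.
  apply: supp_in_linear (IHn _ an) => -[|b t] [] //; rewrite !weight_cons => -[tw tww twm].
  rewrite [X in supp_in _ X]raise_headU; apply: supp_inU; rewrite /below /= tw; split=> //.
  by rewrite !weight_cons addSn tww -addSn val_posPred.
have {a1} aE : a = pos1.
  by apply: posint_eq1; rewrite eqn_leq a1 (valP a).
rewrite linear0 add0r -addrA; apply: supp_inD; first by apply: tailS.
rewrite aE /= -lconsU -linearB.
have sn' : (weight s < n)%N by move: sn; rewrite weight_cons aE.
apply: supp_in_linear (IHn _ sn') => w [ws wts wm].
rewrite [X in supp_in _ X]lconsU; apply: supp_inU; rewrite /below /= ws !weight_cons wts.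
by rewrite ltn_add2l.
Qed.

Lemma dpow_supp s : supp_in (fun w => size w = size s /\ weight w = weight s) (dpow s).
Proof.
by apply: (@supp_in_tri _ s) => //; apply: sub_supp_in (@dpow_triangular s) => w [].
Qed.

(** * The coproduct on the divided-power basis *)

Lemma deltaU i s : delta i << s >> = delta_index i s.
Proof. exact: lextU. Qed.

Lemma delta0 u : delta 0 u = 0.
Proof.
apply: (@malg_linear_eq _ _ (delta 0) (\0 : {linear HH -> HH})) => s.
by rewrite [LHS]deltaU /delta_index /= big_ord0.
Qed.

Lemma delta_big i u : supp_in (fun w => (size w < i)%N) u -> delta i u = 0.
Proof.
apply: (@supp_in_linear_eq _ _ _ (delta i) (\0 : {linear HH -> HH})) => s si.
by rewrite [LHS]deltaU /delta_index leqNgt si.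
Qed.

(** The part of delta that does not touch the first entry is a delta of lower
    index on the tail. *)
Lemma delta_cons l a s : (l <= size s)%N ->
  delta l.+1 << a :: s >> = (val a)%:R *: << posS a :: s >> + lcons a (delta l << s >>).
Proof.
move=> ls; rewrite !deltaU {1}/delta_index /= ltnS ls big_ord_recl; congr (_ + _).
rewrite /delta_index ls linear_sum; apply: eq_bigr => j _.
by rewrite linearZ; congr (_ *: _); rewrite [RHS]lconsU.
Qed.

Lemma raise_head_lcons a u : raise_head (lcons a u) = lcons (posS a) u.
Proof.
apply: (@malg_linear_eq _ _ (raise_head \o lcons a) (lcons (posS a))) => s.
by rewrite [RHS]lconsU [LHS]/= lconsU raise_headU.
Qed.

Lemma scalerDl1 (V : lmodType rat) a (v : V) : (a + 1) *: v = a *: v + v.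
Proof. by rewrite scalerDl scale1r. Qed.

(** delta commutes with x_0 up to x_0 x_0, because the first entry s_1 occurs in
    delta with coefficient s_1.  The condition on the depth excludes the
    truncation of delta to 0. *)
Lemma delta_raise_head l u : supp_in (fun w => (l < size w)%N) u ->
  delta l.+1 (raise_head u) = raise_head (delta l.+1 u) + raise_head (raise_head u).
Proof.
pose R : {linear HH -> HH} := (raise_head \o delta l.+1) \+ (raise_head \o raise_head).
apply: (@supp_in_linear_eq _ _ _ (delta l.+1 \o raise_head) R) => -[//|a s] ls.
have {}ls : (l <= size s)%N by [].
rewrite [LHS]/= [RHS]/= [in LHS]raise_headU [LHS](delta_cons (posS a) ls).
rewrite [in RHS](delta_cons a ls) linearD linearZ /= raise_head_lcons addrAC; congr (_ + _).
rewrite [X in _ = _ + raise_head X]raise_headU [X in _ = _ *: X + _]raise_headU.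
rewrite [X in _ = _ + X]raise_headU.
rewrite (_ : (val (posS a))%:R = (val a)%:R + 1 :> rat); last exact/esym/natr1.
exact: scalerDl1.
Qed.

Lemma delta_lcons1 l u : supp_in (fun w => (l <= size w)%N) u ->
  delta l.+1 (lcons pos1 u) = lcons pos1 (delta l u) + raise_head (lcons pos1 u).
Proof.
pose R : {linear HH -> HH} := (lcons pos1 \o delta l) \+ (raise_head \o lcons pos1).
apply: (@supp_in_linear_eq _ _ _ (delta l.+1 \o lcons pos1) R) => s ls.
rewrite [LHS]/= [RHS]/= [in LHS]lconsU [LHS](delta_cons pos1 ls) scale1r addrC.
by congr (_ + _); rewrite raise_head_lcons lconsU.
Qed.

Section Raise.
Variable V : lmodType rat.
Implicit Types (g : zindex -> V) (s : zindex).

(** Lowering and raising commute except at the raised entry: there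
    s_l - (s_l - 1) = 1 copy of g s remains. *)
Lemma lower_raise l s g : (l < size s)%N ->
  (val (nth pos1 s l))%:R *: lower_sum g (raise l s) =
  lower_sum (fun w => (val (nth pos1 w l))%:R *: g (raise l w)) s + g s.
Proof.
elim: s l g => [//|a s IHs] [|l] g ls; rewrite /raise /= -?/(raise l s) !lower_sum_cons.
  have -> : (1 < val (posS a))%N by exact: (valP a).
  rewrite posSK scalerDr addrAC; congr (_ + _).
    case: ltnP => a1 /=; last first.
      have {a1}a1 : a = pos1 by apply: posint_eq1; rewrite eqn_leq a1 (valP a).
      by rewrite {1}a1 add0r scale1r.
    rewrite posPredK // -scalerDl1 natr1; congr (_%:R *: _).
    exact/esym/(val_posPred a1).
  by rewrite (raddf_lower_sum ( *:%R _)).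
rewrite scalerDr IHs // -/(raise _ _) addrA; congr (_ + _ + _).
by case: ifP => // _; rewrite scaler0.
Qed.

Lemma chop_raise l s g : (l < size s)%N ->
  (val (nth pos1 s l))%:R *: chop_sum g (raise l s) =
  chop_sum (fun w => if l is l'.+1
    then (val (nth pos1 w l'))%:R *: g (raise l' w) else 0) s.
Proof.
case: s l => [//|a s] [|l] ls; rewrite /raise /=.
  by rewrite gtn_eqF ?scaler0 ?if_same //; exact: (valP a).
by rewrite -/(raise _ _); case: ifP; rewrite ?scaler0.
Qed.

End Raise.

(** The defining property of divided powers: delta_l sends dpow s to s_l times dpow of
    s with s_l raised, where the first position is l = 1.  The recursion for dpow turns
    the two sides into the same expression by the commutation of delta with x_0 and x_1. *)
Lemma delta_dpow l s : (l < size s)%N ->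
  delta l.+1 (dpow s) = (val (nth pos1 s l))%:R *: dpow (raise l s).
Proof.
have [n] := ubnP (weight s); elim: n s l => // n IHn s l sn ls.
have s0 : s != [::] by case: s ls {sn}.
have r0 : raise l s != [::] by rewrite -size_eq0 size_raise // size_eq0.
have lowS : supp_in (fun w => (l < size w)%N) (lower_sum dpow s).
  apply: lower_sum_ind; [exact: supp_in0 | exact: supp_inD |].
  by move=> w ws _ _; apply: sub_supp_in (@dpow_supp w) => t [-> _]; rewrite ws.
have chopS : supp_in (fun w => (l <= size w)%N) (chop_sum dpow s).
  case: (s) ls => [//|a t] lt; rewrite /chop_sum; case: ifP => _; last exact: supp_in0.
  by apply: sub_supp_in (@dpow_supp t) => w [-> _].
rewrite {1}(dpow_step s0) [LHS]linearD /= (delta_raise_head lowS) (delta_lcons1 chopS).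
set L := lower_sum dpow s in lowS *; set C := chop_sum dpow s in chopS *.
have -> : raise_head (delta l.+1 L) + raise_head (raise_head L)
    + (lcons pos1 (delta l C) + raise_head (lcons pos1 C))
    = raise_head (delta l.+1 L + dpow s) + lcons pos1 (delta l C).
  by rewrite (dpow_step s0) !linearD /= [LHS](AC (2*2) ((1*(2*4))*3)).
have ZE (a : rat) u v : a *: (raise_head u + lcons pos1 v) =
    raise_head (a *: u) + lcons pos1 (a *: v).
  by rewrite !linearZ scalerDr.
rewrite [dpow (raise l s)](dpow_step r0) ZE (lower_raise _ ls) (chop_raise _ ls).
have -> : delta l.+1 L = lower_sum (fun w => (val (nth pos1 w l))%:R *: dpow (raise l w)) s.
  rewrite /L raddf_lower_sum; apply: eq_lower_sum => w ws wts.
  by apply: IHn; rewrite ?ws // wts.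
congr (_ + lcons pos1 _).
rewrite /C raddf_chop_sum; apply: eq_chop_sum => w ws wts.
case: l ls {r0 lowS chopS} => [|l] ls; first exact: delta0.
by apply: IHn; rewrite ?wts // -ltnS ws.
Qed.

(** For inductions that build an index by raising entries of some [1_k]. *)
Lemma ones_or_raise s :
  s = ones (size s) \/
  exists l s', [/\ (l < size s')%N, s = raise l s' & (weight s').+1 = weight s].
Proof.
elim: s => [|a s IHs]; first by left.
have [a1|a1] := leqP (val a) 1; last first.
  right; exists 0%N, (posPred a :: s); split=> //; first by rewrite /raise /= posPredK.
  by rewrite !weight_cons -addSn val_posPred.
have -> : a = pos1 by apply: posint_eq1; rewrite eqn_leq a1 (valP a).
case: IHs => [{1}->|[l [s' [ls -> ws']]]]; first by left.
right; exists l.+1, (pos1 :: s'); split=> //.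
by rewrite !weight_cons -ws' addnS.
Qed.

(** No entry of [1_k] can be lowered, so only the terms x_1 contribute. *)
Lemma dpow_ones k : dpow (ones k) = << ones k >>.
Proof.
elim: k => [|k IHk]; first exact: dpow_nil.
rewrite dpow_step // [chop_sum _ _]/= IHk lconsU.
rewrite (_ : lower_sum dpow _ = 0) ?linear0 ?add0r //.
by elim: (k.+1) dpow => // m IHm g; rewrite lower_sum_cons add0r IHm.
Qed.

(** A raised entry lies on the left or on the right of each cut. *)
Lemma cut_sum_raise (V : nmodType) l s (h : zindex -> zindex -> V) :
  (l < size s)%N -> cut_sum (raise l s) h =
  cut_sum s (fun p q => if (l < size p)%N then h (raise l p) q
                       else h p (raise (l - size p) q)).
Proof.
elim: s l h => [//|a s IHs] [|l] h ls /=.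
  by congr (_ + _); apply: eq_cut_sum => p q.
by rewrite -/(raise l s) IHs.
Qed.

Lemma id_circS_delta_tens i n u v : supp_in (fun w => size w = n) u ->
  id_circS_delta i (tens u v) = tens u (delta (i - n) v).
Proof.
move=> un; apply: (@linear_tens_eqE _ _ _ (id_circS_delta i)
  (fun u v => tens u (delta (i - n) v))).
- by move=> w a x y; rewrite tensDl tensZl.
- by move=> w a x y; rewrite !linearP.
move=> s t su _; rewrite -(un s su).
exact: (lextU (fun p : zindex * zindex =>
  tens << p.1 >> (delta (i - size p.1) << p.2 >>))).
Qed.

Section Coproduct.
Variable D : HH -> HH2.
Hypothesis hD : is_Delta_ge1 D.

(** By induction on the weight: true for [1_k], and stable under raising an entry,
    since delta_{l+1} (x) id acts on the cuts after position l and id (S)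
    delta_{l+1} on the cuts before it, each with coefficient s_l. *)
Lemma Delta_dpow s : D (dpow s) = cut_sum s (fun p q => tens (dpow p) (dpow q)).
Proof.
have [n] := ubnP (weight s); elim: n s => // n IHn s sn.
case: (ones_or_raise s) => [->|[l [s' [ls sE ws']]]].
  rewrite dpow_ones (Delta_ones hD) cut_sumE size_nseq; apply: eq_bigr => j _.
  have jk : (j <= size s)%N by rewrite -ltnS.
  rewrite (take_nseq _ jk) drop_nseq -/(ones j) -/(ones (size s - j)).
  by rewrite (dpow_ones j) (dpow_ones (size s - j)).
rewrite sE in sn ws' *.
set v : rat := (val (nth pos1 s' l))%:R.
have v0 : v != 0 by rewrite Num.Theory.pnatr_eq0 -lt0n; exact: (valP (nth _ _ _)).
(* The raised entry of s' contributes its value v to every cut. *)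
have cut_v : v *: cut_sum (raise l s') (fun p q => tens (dpow p) (dpow q)) =
    cut_sum s' (fun p q => id_circS_delta l.+1 (tens (dpow p) (dpow q))
                          + tmap (delta l.+1) id (tens (dpow p) (dpow q))).
  rewrite cut_sum_raise // (raddf_cut_sum ( *:%R v)) /=; apply: eq_cut_sum_cat => p q pq.
  have Ep : supp_in (fun w => size w = size p) (dpow p).
    by apply: sub_supp_in (@dpow_supp p) => w [].
  rewrite (id_circS_delta_tens _ _ Ep) (tmap_tens (delta l.+1) idfun) /v -pq nth_cat.
  case: ltnP => lp.
    have -> : (l.+1 - size p = 0)%N by apply/eqP; rewrite subn_eq0.
    by rewrite delta0 linear0 add0r [X in _ = tens X _](delta_dpow lp) tensZl.
  rewrite [X in _ = _ + tens X _]delta_big; last first.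
    by apply: sub_supp_in Ep => w ->; rewrite ltnS.
  have lq : (l - size p < size q)%N by rewrite ltn_subLR // -size_cat pq.
  by rewrite tens0l addr0 subSn // (delta_dpow lq) linearZ.
apply: (scalerI v0); rewrite cut_v.
rewrite -(GRing.scalable_linear (Delta_linear hD)) -(delta_dpow ls) -(Delta_delta hD) // IHn.
  by rewrite !raddf_cut_sum -cut_sumD.
by move: sn; rewrite -ws' ltnS.
Qed.

End Coproduct.
(** * The shuffle product on the divided-power basis *)

HB.instance Definition _ u :=
  GRing.isLinear.Build rat _ _ _ (shuffle u) (lext2_is_linearr shuffle_word u).

Definition shuffler v u := shuffle u v.
HB.instance Definition _ v :=
  GRing.isLinear.Build rat _ _ _ (shuffler v) (lext2_is_linearl shuffle_word v).

Lemma shuffle_is_linearl v : linear (shuffle^~ v).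
Proof. exact: lext2_is_linearl. Qed.

Lemma shuffleUU w w' : shuffle << w >> << w' >> = shuffle_word w w'.
Proof. exact: lext2U. Qed.

Lemma shuffleDl u u' v : shuffle (u + u') v = shuffle u v + shuffle u' v.
Proof. exact: (linearD (shuffler v)). Qed.

Lemma shuffleDr u v v' : shuffle u (v + v') = shuffle u v + shuffle u v'.
Proof. exact: linearD. Qed.

Lemma wconsD a u v : wcons a (u + v) = wcons a u + wcons a v.
Proof. exact: linearD. Qed.

Lemma wconsU a w : wcons a << w >> = << a :: w >>.
Proof. exact: lextU. Qed.

Lemma shuffle_wcons a b u v :
  shuffle (wcons a u) (wcons b v) =
  wcons a (shuffle u (wcons b v)) + wcons b (shuffle (wcons a u) v).
Proof.
pose B u v := shuffle (wcons a u) (wcons b v).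
pose B' u v := wcons a (shuffle u (wcons b v)) + wcons b (shuffle (wcons a u) v).
apply: (@bilinear_eq _ _ _ B B'); rewrite /B /B'.
- by move=> w c x y; rewrite linearP shuffle_is_linearl.
- by move=> w c x y; rewrite !linearP.
- move=> w c x y; rewrite shuffle_is_linearl linearP [wcons a (_ + _)]linearP.
  by rewrite shuffle_is_linearl linearP scalerDr addrACA.
- by move=> w c x y; rewrite !linearP scalerDr addrACA.
by move=> w w' _ _; rewrite !wconsU !shuffleUU.
Qed.

(** The removal of the first letter is a derivation of the shuffle product, stated
    for words of positive length split by their first letter. *)
Lemma shuffle_wconsD u0 u1 v0 v1 :
  let u := wcons false u0 + wcons true u1 in
  let v := wcons false v0 + wcons true v1 in
  shuffle u v = wcons false (shuffle u0 v + shuffle u v0)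
                + wcons true (shuffle u1 v + shuffle u v1).
Proof.
move=> u v.
have half a x : shuffle (wcons a x) v = wcons a (shuffle x v)
    + (wcons false (shuffle (wcons a x) v0) + wcons true (shuffle (wcons a x) v1)).
  rewrite /v shuffleDr (shuffle_wcons a false x v0) (shuffle_wcons a true x v1).
  by rewrite (shuffleDr x) (wconsD a); exact: addrACA.
rewrite {1}/u shuffleDl (half false) (half true).
rewrite [shuffle u v0]shuffleDl [shuffle u v1]shuffleDl !(wconsD false) !(wconsD true).
exact: (AC ((1*2)*(1*2)) ((1*(2*5))*(4*(3*6)))).
Qed.

Lemma rhoU s : rho << s >> = << rho_word s >>.
Proof. exact: lextU. Qed.

Lemma rho_word_posS a s : rho_word (posS a :: s) = false :: rho_word (a :: s).
Proof. by case: a => [[]]. Qed.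

Lemma rho_raise_head u : supp_in (fun w => w != [::]) u -> rho (raise_head u) = wcons false (rho u).
Proof.
apply: (@supp_in_linear_eq _ _ _ (rho \o raise_head) (wcons false \o rho)) => -[//|a s] _.
rewrite [LHS]/= [RHS]/= [in LHS]raise_headU [LHS]rhoU [in RHS]rhoU [RHS]wconsU.
by rewrite rho_word_posS.
Qed.

Lemma rho_lcons1 u : rho (lcons pos1 u) = wcons true (rho u).
Proof.
apply: (@malg_linear_eq _ _ (rho \o lcons pos1) (wcons true \o rho)) => s.
by rewrite [LHS]/= [RHS]/= [in LHS]lconsU [LHS]rhoU [in RHS]rhoU [RHS]wconsU.
Qed.

Lemma rho_dpow_step s : s != [::] ->
  rho (dpow s) = wcons false (lower_sum (fun w => rho (dpow w)) s)
              + wcons true (chop_sum (fun w => rho (dpow w)) s).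
Proof.
move=> s0; rewrite (dpow_step s0) linearD /= rho_lcons1 rho_raise_head.
  by rewrite (raddf_lower_sum rho) (raddf_chop_sum rho).
apply: lower_sum_ind; [exact: supp_in0 | exact: supp_inD |].
move=> w ws _ _; apply: sub_supp_in (@dpow_supp w) => t [ts _].
by rewrite -size_eq0 ts ws size_eq0.
Qed.

(** Both sides have the same two derivatives by the first letter: on the left
    these are derivations of the shuffle product of words, on the right
    lower_sum and chop_sum, which are derivations of letterwise shuffling. *)
Lemma shuffle_rho_dpow s t :
  shuffle (rho (dpow s)) (rho (dpow t)) = shuffle_sum s t (fun w => rho (dpow w)).
Proof.
have rho1 : rho (dpow [::]) = << [::] >> by rewrite dpow_nil; exact: rhoU.
have shuffle1 u : shuffle << [::] >> u = u.
  apply: (@malg_linear_eq _ _ (shuffle << [::] >>) idfun) => w.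
  by rewrite [LHS]shuffleUU.
have shuffle1r u : shuffle u << [::] >> = u.
  apply: (@malg_linear_eq _ _ (shuffler << [::] >>) idfun) => w.
  by rewrite [LHS]shuffleUU; case: w.
have [n] := ubnP (weight s + weight t)%N; elim: n s t => // n IHn s t.
have [->|s0] := eqVneq s [::]; first by rewrite rho1 shuffle1.
have [->|t0] := eqVneq t [::]; first by rewrite rho1 shuffle1r shuffle_sum_nilr.
move=> stn; rewrite [RHS](eq_shuffle_sum_perm (g' := fun w =>
    wcons false (lower_sum (fun w => rho (dpow w)) w)
    + wcons true (chop_sum (fun w => rho (dpow w)) w))); last first.
  move=> w /perm_size wst; apply: rho_dpow_step; rewrite -size_eq0 wst size_cat.
  by rewrite addn_eq0 negb_and size_eq0 s0.
rewrite shuffle_sumD -!raddf_shuffle_sum lower_shuffle_sum chop_shuffle_sum.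
rewrite (rho_dpow_step s0) (rho_dpow_step t0).
rewrite shuffle_wconsD -(rho_dpow_step s0) -(rho_dpow_step t0).
pose W w := rho (dpow w).
have lows : shuffle (lower_sum W s) (W t) = lower_sum (fun w => shuffle_sum w t W) s.
  rewrite -[LHS]/(shuffler (W t) (lower_sum W s)) raddf_lower_sum.
  by apply: eq_lower_sum => w _ ws; apply: IHn; rewrite -ltnS -addSn ws.
have lowt : shuffle (W s) (lower_sum W t) = lower_sum (fun w => shuffle_sum s w W) t.
  rewrite raddf_lower_sum.
  by apply: eq_lower_sum => w _ wt; apply: IHn; rewrite -ltnS -addnS wt.
have chops : shuffle (chop_sum W s) (W t) = chop_sum (fun w => shuffle_sum w t W) s.
  rewrite -[LHS]/(shuffler (W t) (chop_sum W s)) raddf_chop_sum.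
  by apply: eq_chop_sum => w _ ws; apply: IHn; rewrite -ltnS -addSn ws.
have chopt : shuffle (W s) (chop_sum W t) = chop_sum (fun w => shuffle_sum s w W) t.
  rewrite raddf_chop_sum.
  by apply: eq_chop_sum => w _ wt; apply: IHn; rewrite -ltnS -addnS wt.
by rewrite -/(W s) -/(W t) lows lowt chops chopt.
Qed.

Lemma unrho_rho u : unrho (rho u) = u.
Proof.
apply: (@malg_linear_eq _ _ (unrho \o rho) idfun) => s.
by rewrite [LHS]/= [in LHS]rhoU [LHS]lextU rho_wordK.
Qed.

Lemma shuffleH_dpow s t : shuffleH (dpow s) (dpow t) = shuffle_sum s t dpow.
Proof.
rewrite /shuffleH shuffle_rho_dpow raddf_shuffle_sum.
by apply: eq_shuffle_sum => w; apply: unrho_rho.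
Qed.

(** * The quasi-shuffle product *)

Lemma qshuffle_is_linearl v : linear (qshuffleH^~ v).
Proof. exact: lext2_is_linearl. Qed.

HB.instance Definition _ u :=
  GRing.isLinear.Build rat _ _ _ (qshuffleH u) (lext2_is_linearr qshuffle_index u).

Definition qshuffler v u := qshuffleH u v.
HB.instance Definition _ v :=
  GRing.isLinear.Build rat _ _ _ (qshuffler v) (qshuffle_is_linearl v).

Lemma qshuffleZl a u v : qshuffleH (a *: u) v = a *: qshuffleH u v.
Proof. exact: (linearZ_LR (qshuffler v)). Qed.

Lemma qshuffleZr a u v : qshuffleH u (a *: v) = a *: qshuffleH u v.
Proof. exact: (linearZ_LR (qshuffleH u)). Qed.

Lemma qshuffleUU s t : qshuffleH << s >> << t >> = qshuffle_index s t.
Proof. exact: lext2U. Qed.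

Lemma lconsD a u v : lcons a (u + v) = lcons a u + lcons a v.
Proof. exact: linearD. Qed.

Lemma lconsZ a (x : rat) u : lcons a (x *: u) = x *: lcons a u.
Proof. exact: linearZ. Qed.

Lemma qshuffle_lcons a b u v :
  qshuffleH (lcons a u) (lcons b v) =
  lcons a (qshuffleH u (lcons b v)) + lcons b (qshuffleH (lcons a u) v)
  + lcons (posD a b) (qshuffleH u v).
Proof.
pose B u v := qshuffleH (lcons a u) (lcons b v).
pose B1 u v := lcons a (qshuffleH u (lcons b v)).
pose B2 u v := lcons b (qshuffleH (lcons a u) v).
pose B3 u v := lcons (posD a b) (qshuffleH u v).
apply: (@bilinear_eq _ _ _ B (fun u v => B1 u v + B2 u v + B3 u v));
  rewrite /B /B1 /B2 /B3.
- by move=> w x y z; rewrite lconsD lconsZ qshuffle_is_linearl.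
- by move=> w x y z; rewrite !linearP.
- move=> w x y z; rewrite lconsD lconsZ !qshuffle_is_linearl !lconsD !lconsZ.
  by rewrite !scalerDr; exact: (AC (2*2*2) ((1*3*5)*(2*4*6))).
- move=> w x y z; rewrite !(linearP (qshuffleH _)) !lconsD !lconsZ.
  rewrite !(linearP (qshuffleH _)) !lconsD !lconsZ.
  by rewrite !scalerDr; exact: (AC (2*2*2) ((1*3*5)*(2*4*6))).
by move=> w w' _ _; rewrite !lconsU !qshuffleUU.
Qed.

Lemma qshuffle1l u : qshuffleH Hone u = u.
Proof.
apply: (@malg_linear_eq _ _ (qshuffleH Hone) idfun) => s.
by rewrite [LHS]qshuffleUU.
Qed.

Lemma qshuffle1r u : qshuffleH u Hone = u.
Proof.
apply: (@malg_linear_eq _ _ (qshuffler Hone) idfun) => s.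
by rewrite [LHS]qshuffleUU; case: s.
Qed.

Lemma Hcounit_is_linear : linear (Hcounit : HH -> rat^o).
Proof. by move=> a u v; rewrite /Hcounit mcoeffD mcoeffZ. Qed.

Lemma chiQE u : chiQ u = lext (fun s => (size s <= 1)%:R : rat^o) u.
Proof.
rewrite /chiQ big_mkcond; apply: eq_bigr => s _.
by case: ifP => _; rewrite /GRing.scale /= ?mulr1 ?mulr0.
Qed.

Lemma chiQ_is_linear : linear (chiQ : HH -> rat^o).
Proof. by move=> a u v; rewrite !chiQE linearP. Qed.

Lemma HcounitU s : Hcounit << s >> = (s == [::])%:R.
Proof. by rewrite /Hcounit mcoeffU. Qed.

Lemma chiQU s : chiQ << s >> = (size s <= 1)%:R.
Proof. by rewrite chiQE lextU. Qed.

Lemma Hcounit_lcons a u : Hcounit (lcons a u) = 0.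
Proof.
apply: (@malg_linear_eq _ _ (linear_of Hcounit_is_linear \o lcons a)
  (\0 : {linear HH -> rat^o})) => s.
by rewrite [LHS]/= lconsU HcounitU.
Qed.

(** chiQ vanishes in depth at least 2, so it only sees the empty tail. *)
Lemma chiQ_lcons a u : chiQ (lcons a u) = Hcounit u.
Proof.
apply: (@malg_linear_eq _ _ (linear_of chiQ_is_linear \o lcons a)
  (linear_of Hcounit_is_linear)) => s.
by rewrite [LHS]/= lconsU chiQU [RHS]HcounitU /= ltnS leqn0 size_eq0.
Qed.

Lemma functionalD (f : HH -> rat) : linear (f : HH -> rat^o) -> {morph f : u v / u + v}.
Proof. by move=> fl u v; have := fl 1 u v; rewrite !scale1r. Qed.

(** Multiplicativity of a functional only has to be tested on products of two
    elements without constant term. *)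
Lemma qshuffle_functional_mul (f : HH -> rat) u v : linear (f : HH -> rat^o) ->
  f Hone = 1 ->
  (forall a b u v, f (qshuffleH (lcons a u) (lcons b v)) = f (lcons a u) * f (lcons b v)) ->
  f (qshuffleH u v) = f u * f v.
Proof.
move=> fl f1 fM; apply: (@bilinear_eq _ _ rat^o (fun u v => f (qshuffleH u v))
  (fun u v => f u * f v)).
- by move=> w a x y; rewrite qshuffle_is_linearl fl.
- by move=> w a x y; rewrite linearP fl.
- by move=> w a x y; rewrite fl mulrDl; congr (_ + _); apply/esym/mulrA.
- by move=> w a x y; rewrite fl mulrDr; congr (_ + _); apply: mulrCA.
move=> [|a s] t _ _; first by rewrite [qshuffleH _ _]qshuffle1l [f << [::] >>]f1 mul1r.
case: t => [|b t].
  by rewrite [qshuffleH _ _]qshuffle1r [X in _ = _ * X]f1 mulr1.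
by rewrite -(lconsU a s) -(lconsU b t) fM.
Qed.

Lemma functionalZ (f : HH -> rat) a u : linear (f : HH -> rat^o) -> f (a *: u) = a * f u.
Proof. by move=> fl; apply: (GRing.scalable_linear fl). Qed.

Lemma Hcounit_mul u v : Hcounit (qshuffleH u v) = Hcounit u * Hcounit v.
Proof.
apply: qshuffle_functional_mul; [exact: Hcounit_is_linear | exact: HcounitU |].
move=> a b x y; rewrite qshuffle_lcons !(functionalD Hcounit_is_linear).
rewrite [X in X + _ + _]Hcounit_lcons [X in _ + X + _]Hcounit_lcons.
by rewrite [X in _ + X]Hcounit_lcons [X in _ = X * _]Hcounit_lcons mul0r !addr0.
Qed.

(** Of the three terms of a product of nonempty words, only the stuffed one can
    have depth 1, and it does when both factors have depth 1. *)
Lemma chiQ_mul u v : chiQ (qshuffleH u v) = chiQ u * chiQ v.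
Proof.
apply: qshuffle_functional_mul; [exact: chiQ_is_linear | exact: chiQU |].
move=> a b x y; rewrite qshuffle_lcons !(functionalD chiQ_is_linear).
rewrite [X in X + _ + _]chiQ_lcons [X in _ + X + _]chiQ_lcons [X in _ + X]chiQ_lcons.
rewrite [X in X + _ + _]Hcounit_mul [X in _ + X + _]Hcounit_mul [X in _ + X]Hcounit_mul.
rewrite [X in _ * X + _ + _]Hcounit_lcons [X in _ + X * _ + _]Hcounit_lcons.
by rewrite mulr0 mul0r !add0r [X in _ = X * _]chiQ_lcons [X in _ = _ * X]chiQ_lcons.
Qed.

Lemma Ddec_cut_sum s : Ddec << s >> = cut_sum s (fun p q => << (p, q) >>).
Proof. by rewrite cut_sumE; apply: lextU. Qed.

Lemma Ddec_lcons a u :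
  Ddec (lcons a u) = tens Hone (lcons a u) + tmap (lcons a) idfun (Ddec u).
Proof.
pose R : {linear HH -> HH2} :=
  (tens Hone \o lcons a) \+ (tmap (lcons a) idfun \o Ddec).
apply: (@malg_linear_eq _ _ (Ddec \o lcons a) R) => s.
rewrite [LHS]/= [RHS]/= lconsU !Ddec_cut_sum /= tensUU; congr (_ + _).
rewrite [RHS]raddf_cut_sum; apply: eq_cut_sum => p q.
by rewrite -[in RHS]tensUU [RHS](tmap_tens (lcons a) idfun) /= lconsU tensUU.
Qed.

(** * The homomorphism attached to a character *)

Lemma size_cut (A : Type) (a : A) s p q n :
  p ++ q = s -> (size (a :: s) < n.+1)%N -> (size q < n)%N.
Proof. by move=> <-; rewrite /= ltnS size_cat; apply/leq_ltn_trans/leq_addl. Qed.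

Section CutTools.
Variables (A : eqType) (V : nmodType).

Lemma cut_sum_ind (P : V -> Prop) s (h : seq A -> seq A -> V) :
  (forall x y, P x -> P y -> P (x + y)) ->
  (forall p q, p ++ q = s -> P (h p q)) -> P (cut_sum s h).
Proof.
move=> PD; elim: s h => [|a s IHs] h Ph /=; first exact: Ph.
by apply: PD; [apply: Ph | apply: IHs => p q pq; apply: Ph; rewrite /= pq].
Qed.

Lemma cut_sum_nilr s (h : seq A -> seq A -> V) :
  (forall p q, q != [::] -> h p q = 0) -> cut_sum s h = h s [::].
Proof.
elim: s h => [//|a s IHs] h h0 /=.
by rewrite h0 // add0r IHs // => p q q0; apply: h0.
Qed.

Lemma cut_sumC s t (h : seq A -> seq A -> seq A -> seq A -> V) :
  cut_sum s (fun p q => cut_sum t (fun p' q' => h p q p' q')) =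
  cut_sum t (fun p' q' => cut_sum s (fun p q => h p q p' q')).
Proof.
elim: s h => [//|a s IHs] h /=.
by rewrite IHs -cut_sumD.
Qed.

End CutTools.

Lemma shuffle_sum_scalel (A : eqType) (R : pzRingType) (V : lmodType R) (s t : seq A)
    (f : seq A -> R) (v : V) :
  shuffle_sum s t (fun w => f w *: v) = shuffle_sum s t f *: v.
Proof.
elim: s t f => [|a s IHs] // t; elim: t => [|b t IHt] // f.
by rewrite !shuffle_sum_cons scalerDl IHs IHt.
Qed.

(** Blocks are nonempty wherever the value matters; the predecessor sends the empty
    one to the letter 1. *)
Definition weight_letter (p : zindex) : posint := mkpos (weight p).-1.

Lemma val_weight_letter p : p != [::] -> val (weight_letter p) = weight p.
Proof. by move=> p0; rewrite /= prednK // lt0n weight_eq0. Qed.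

Lemma weight_letter1 a : weight_letter [:: a] = a.
Proof. by apply: val_inj; rewrite val_weight_letter // weight_cons weight_nil addn0. Qed.

Lemma weight_letter_cat p p' : p != [::] -> p' != [::] ->
  weight_letter (p ++ p') = posD (weight_letter p) (weight_letter p').
Proof.
move=> p0 p'0; have pp0 : p ++ p' != [::] by case: (p) p0.
by apply: val_inj; rewrite val_weight_letter // weight_cat -!val_weight_letter.
Qed.

Lemma weight_letter_perm p p' : perm_eq p p' -> weight_letter p = weight_letter p'.
Proof. by move=> pp'; rewrite /weight_letter (weight_perm pp'). Qed.

Section CharacterMap.
Variable c : zindex -> rat.

(** The first block a :: p is split off; n bounds the number of letters left. *)
Fixpoint char_hom_rec (n : nat) (s : zindex) : HH :=
  if n is n'.+1 then
    if s is a :: s' then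
      cut_sum s' (fun p q => c (a :: p) *: lcons (weight_letter (a :: p)) (char_hom_rec n' q))
    else Hone
  else Hone.

(** Sum over the ways to cut s into nonempty blocks, each block contributing
    its value under c and its weight as a letter. *)
Definition char_hom (s : zindex) : HH := char_hom_rec (size s) s.

Lemma char_hom_cons a s : char_hom (a :: s) =
  cut_sum s (fun p q => c (a :: p) *: lcons (weight_letter (a :: p)) (char_hom q)).
Proof.
have enough n m w : (size w <= n)%N -> (size w <= m)%N -> char_hom_rec n w = char_hom_rec m w.
  elim: n m w => [|n IHn] m [|b w] wn wm; [by case: (m) | by [] | by case: (m) |].
  case: m wm => [//|m] wm; apply: eq_cut_sum_cat => p q pq.
  have qw : (size q <= size w)%N by rewrite -pq size_cat leq_addl.
  have e : char_hom_rec n q = char_hom_rec m q by apply: IHn; apply: leq_trans qw _.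
  exact: (congr1 (fun x => c (b :: p) *: lcons (weight_letter (b :: p)) x) e).
apply: eq_cut_sum_cat => p q pq.
have e : char_hom_rec (size s) q = char_hom q by apply: enough; rewrite // -pq size_cat leq_addl.
exact: (congr1 (fun x => c (a :: p) *: lcons (weight_letter (a :: p)) x) e).
Qed.

Lemma char_hom_supp s : supp_in (fun w => weight w = weight s /\ (size w <= size s)%N) (char_hom s).
Proof.
have [n] := ubnP (size s); elim: n s => // n IHn [|a s] sn.
  exact: supp_inU.
rewrite char_hom_cons; apply: cut_sum_ind => [|p q pq]; first exact: supp_inD.
apply: supp_inZ; have qn := size_cut pq sn.
apply: supp_in_linear (IHn _ qn) => w [ww wq]; rewrite [X in supp_in _ X]lconsU.
apply: supp_inU; rewrite !weight_cons val_weight_letter // ww weight_cons -addnA.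
by rewrite -weight_cat pq /= ltnS (leq_trans wq) // -pq size_cat leq_addl.
Qed.

(** The contribution of the finest cut, into single letters. *)
Definition diag (s : zindex) : rat := \prod_(a <- s) c [:: a].

(** Any cut other than the finest one has fewer blocks than s has letters. *)
Lemma char_hom_triangular s :
  supp_in (fun w => weight w = weight s /\ (size w < size s)%N) (char_hom s - diag s *: << s >>).
Proof.
elim: s => [|a s IHs].
  by rewrite /diag big_nil scale1r subrr; apply: supp_in0.
have lower p q : p ++ q = s -> p != [::] ->
    supp_in (fun w => weight w = weight (a :: s) /\ (size w < size (a :: s))%N)
      (c (a :: p) *: lcons (weight_letter (a :: p)) (char_hom q)).
  move=> pq p0; apply: supp_inZ; apply: supp_in_linear (@char_hom_supp q) => w [ww wq].
  rewrite [X in supp_in _ X]lconsU; apply: supp_inU.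
  rewrite !weight_cons val_weight_letter // ww weight_cons -addnA -weight_cat pq; split=> //.
  by rewrite /= ltnS (leq_ltn_trans wq) // -pq size_cat -[ltnLHS]add0n ltn_add2r lt0n size_eq0.
have head : supp_in (fun w => weight w = weight (a :: s) /\ (size w < size (a :: s))%N)
    (c [:: a] *: lcons a (char_hom s) - diag (a :: s) *: << a :: s >>).
  rewrite /diag big_cons -scalerA -scalerBr -(lconsU a s) -lconsZ.
  rewrite (_ : _ - _ = lcons a (char_hom s - diag s *: << s >>)); last exact/esym/linearB.
  apply: supp_inZ; apply: supp_in_linear IHs => w [ww ws].
  by rewrite [X in supp_in _ X]lconsU; apply: supp_inU; rewrite !weight_cons ww.
rewrite char_hom_cons; case: s {IHs} lower head => [|b s] lower head.
  by rewrite [cut_sum _ _]/= weight_letter1.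
rewrite [cut_sum _ _]/= -/(char_hom (b :: s)) weight_letter1 addrAC.
apply: supp_inD; first exact: head.
apply: cut_sum_ind => [|p q pq]; first exact: supp_inD.
by apply: lower; rewrite //= pq.
Qed.

Lemma Hcounit_char_hom s : Hcounit (char_hom s) = (s == [::])%:R.
Proof.
case: s => [|a s]; first exact: HcounitU.
rewrite char_hom_cons; pose L := linear_of Hcounit_is_linear.
rewrite -[Hcounit _]/(L _) raddf_cut_sum -[RHS](cut_sum0 _ s); apply: eq_cut_sum => p q.
apply: etrans (functionalZ _ _ Hcounit_is_linear) _.
by rewrite Hcounit_lcons mulr0.
Qed.

Hypothesis c1 : c [::] = 1.

(** Only the cut with a single block has depth at most 1. *)
Lemma chiQ_char_hom s : chiQ (char_hom s) = c s.
Proof.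
case: s => [|a s]; first by rewrite c1; exact: chiQU.
rewrite char_hom_cons; pose L := linear_of chiQ_is_linear.
rewrite -[chiQ _]/(L _) raddf_cut_sum.
pose h p (q : zindex) : rat := c (a :: p) * (q == [::])%:R.
rewrite (eq_cut_sum _ (h' := h)) => [|p q].
  by rewrite cut_sum_nilr /h ?mulr1 // => p q /negbTE ->; rewrite mulr0.
apply: etrans (functionalZ _ _ chiQ_is_linear) _.
by rewrite chiQ_lcons Hcounit_char_hom.
Qed.

(** To cut s into blocks and then the list of blocks in two is to cut s in two
    and then both parts into blocks. *)
Lemma Ddec_char_hom s : Ddec (char_hom s) = cut_sum s (fun p q => tens (char_hom p) (char_hom q)).
Proof.
have [n] := ubnP (size s); elim: n s => // n IHn [|a s] sn.
  by rewrite [LHS]Ddec_cut_sum; apply/esym/tensUU.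
have expand p q : p ++ q = s ->
    Ddec (c (a :: p) *: lcons (weight_letter (a :: p)) (char_hom q)) =
    tens Hone (c (a :: p) *: lcons (weight_letter (a :: p)) (char_hom q)) +
    cut_sum q (fun p' q' =>
      tens (c (a :: p) *: lcons (weight_letter (a :: p)) (char_hom p')) (char_hom q')).
  move=> pq; rewrite linearZ /= Ddec_lcons scalerDr linearZ; congr (_ + _).
  rewrite (IHn _ (size_cut pq sn)).
  rewrite raddf_cut_sum (raddf_cut_sum ( *:%R _)); apply: eq_cut_sum => p' q' /=.
  by rewrite [X in _ *: X](tmap_tens (lcons _) idfun) tensZl.
rewrite {1}char_hom_cons raddf_cut_sum (eq_cut_sum_cat expand) cut_sumD cut_sum_coassoc.
rewrite -(raddf_cut_sum (tens Hone)) -char_hom_cons.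
have tail p q : cut_sum p (fun p' q' =>
    tens (c (a :: p') *: lcons (weight_letter (a :: p')) (char_hom q')) (char_hom q)) =
    tens (char_hom (a :: p)) (char_hom q).
  rewrite -[RHS]/(tensr (char_hom q) (char_hom (a :: p))) char_hom_cons raddf_cut_sum.
  by apply: eq_cut_sum => p' q'.
by rewrite (eq_cut_sum _ tail).
Qed.

Hypothesis cM : forall s t, shuffle_sum s t c = c s * c t.

(** The first block of a cut of a shuffle of s and t is a shuffle of a prefix p of s
    and a prefix p' of t, not both empty.  Multiplicativity of c makes the total value
    of these shuffles c p c p'.  The cases p' empty, p empty and neither empty give the
    three terms of the quasi-shuffle product. *)
Lemma char_hom_mul s t : shuffle_sum s t char_hom = qshuffleH (char_hom s) (char_hom t).
Proof.
have [n] := ubnP (size s + size t)%N; elim: n s t => // n IHn [|a s] t stn.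
  by rewrite qshuffle1l.
case: t stn => [|b t] stn; first by rewrite shuffle_sum_nilr qshuffle1r.
(* h p q is the contribution of the first block p; the value 0 at the empty
   block lets the sum run over all cuts. *)
pose h p q := if p is [::] then 0 else c p *: lcons (weight_letter p) (char_hom q).
have Fh w : w != [::] -> char_hom w = cut_sum w h.
  by case: w => // d w _; rewrite char_hom_cons /= add0r.
pose T p q p' q' := (c p * c p') *:
  lcons (weight_letter (p ++ p')) (qshuffleH (char_hom q) (char_hom q')).
have hT p q p' q' : p ++ q = a :: s -> p' ++ q' = b :: t -> p ++ p' != [::] ->
    shuffle_sum p p' (fun u => shuffle_sum q q' (h u)) = T p q p' q'.
  move=> pq pq' pp0; have small : (size q + size q' < n)%N.
    rewrite -ltnS; apply: leq_trans stn; rewrite -pq -pq' !size_cat ltnS.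
    by rewrite addnACA -[ltnLHS]add0n ltn_add2r -size_cat lt0n size_eq0.
  rewrite /T -cM -(IHn _ _ small).
  pose B : HH := lcons (weight_letter (p ++ p')) (shuffle_sum q q' char_hom).
  have -> : shuffle_sum p p' c *: B = shuffle_sum p p' (fun u => c u *: B).
    exact/esym/shuffle_sum_scalel.
  apply: eq_shuffle_sum_perm => u upp; rewrite /B -(weight_letter_perm upp).
  case: u upp => [|d u] upp; first by move: pp0; rewrite -size_eq0 -(perm_size upp).
  by rewrite !raddf_shuffle_sum.
pose T0 p q p' q' := if p ++ p' is [::] then 0 else T p q p' q'.
have lhsE : shuffle_sum (a :: s) (b :: t) char_hom =
    cut_sum (a :: s) (fun p q => cut_sum (b :: t) (fun p' q' => T0 p q p' q')).
  rewrite (eq_shuffle_sum_perm (g' := fun w => cut_sum w h)); last first.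
    by move=> w /perm_size ws; apply: Fh; rewrite -size_eq0 ws.
  rewrite shuffle_sum_cut_sum; apply: eq_cut_sum_cat => p q pq; apply: eq_cut_sum_cat => p' q' pq'.
  have := hT p q p' q' pq pq'; rewrite /T0.
  case: p {pq} => [|d p]; last by apply.
  by case: p' {pq'} => [_|d p']; [exact: shuffle_sum0 | apply].
have {}lhsE : shuffle_sum (a :: s) (b :: t) char_hom =
    cut_sum t (fun p' q' => T [::] (a :: s) (b :: p') q') +
    cut_sum s (fun p q => T (a :: p) q [::] (b :: t) +
      cut_sum t (fun p' q' => T (a :: p) q (b :: p') q')).
  rewrite lhsE; pose X := cut_sum t (fun p' q' => T0 [::] (a :: s) (b :: p') q').
  exact: (congr1 (fun x => x + _) (add0r X)).
pose A p := weight_letter (a :: p); pose B p := weight_letter (b :: p).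
have FaE : char_hom (a :: s) = cut_sum s (fun p q => c (a :: p) *: lcons (A p) (char_hom q)).
  exact: char_hom_cons.
have FbE : char_hom (b :: t) = cut_sum t (fun p q => c (b :: p) *: lcons (B p) (char_hom q)).
  exact: char_hom_cons.
have part1 : cut_sum t (fun p' q' => T [::] (a :: s) (b :: p') q') =
    cut_sum t (fun p' q' => cut_sum s (fun p q => (c (a :: p) * c (b :: p')) *:
      lcons (B p') (qshuffleH (lcons (A p) (char_hom q)) (char_hom q')))).
  apply: eq_cut_sum => p' q'; rewrite /T c1 mul1r.
  rewrite -[qshuffleH _ _]/(qshuffler (char_hom q') (char_hom (a :: s))) FaE.
  rewrite raddf_cut_sum raddf_cut_sum (raddf_cut_sum ( *:%R _)).
  apply: eq_cut_sum => p q; rewrite [_ * c (b :: _)]mulrC -scalerA; congr (_ *: _).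
  exact: etrans (congr1 (lcons (B p')) (qshuffleZl _ _ _)) (lconsZ _ _ _).
have part2 p q : T (a :: p) q [::] (b :: t) =
    cut_sum t (fun p' q' => (c (a :: p) * c (b :: p')) *:
      lcons (A p) (qshuffleH (char_hom q) (lcons (B p') (char_hom q')))).
  rewrite /T c1 mulr1 cats0 FbE.
  rewrite raddf_cut_sum raddf_cut_sum (raddf_cut_sum ( *:%R _)).
  apply: eq_cut_sum => p' q'; rewrite -scalerA; apply: (congr1 ( *:%R _)).
  exact: etrans (congr1 (lcons (A p)) (qshuffleZr _ _ _)) (lconsZ _ _ _).
have part3 p q p' q' : T (a :: p) q (b :: p') q' = (c (a :: p) * c (b :: p')) *:
    lcons (posD (A p) (B p')) (qshuffleH (char_hom q) (char_hom q')).
  by rewrite /T weight_letter_cat.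
have rhsE : qshuffleH (char_hom (a :: s)) (char_hom (b :: t)) =
    cut_sum s (fun p q => cut_sum t (fun p' q' => (c (a :: p) * c (b :: p')) *:
      qshuffleH (lcons (A p) (char_hom q)) (lcons (B p') (char_hom q')))).
  rewrite -[LHS]/(qshuffler (char_hom (b :: t)) (char_hom (a :: s))) FaE raddf_cut_sum.
  apply: eq_cut_sum => p q; apply: etrans (qshuffleZl _ _ _) _.
  rewrite FbE raddf_cut_sum (raddf_cut_sum ( *:%R _)); apply: eq_cut_sum => p' q'.
  by rewrite -scalerA; apply: (congr1 ( *:%R _) (qshuffleZr _ _ _)).
apply: etrans lhsE (etrans _ (esym rhsE)).
apply: etrans (congr1 (fun x => x + _) (etrans part1 (cut_sumC _ _ _))) _.
apply: etrans (esym (cut_sumD _ _ _)) _; apply: eq_cut_sum => p q; rewrite part2.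
apply: etrans (congr1 (fun x => _ + x) (esym (cut_sumD _ _ _))) _.
apply: etrans (esym (cut_sumD _ _ _)) _; apply: eq_cut_sum => p' q'.
rewrite part3 qshuffle_lcons !scalerDr.
exact: (AC (1*(1*1)) ((2*1)*3)).
Qed.

End CharacterMap.

(** * Triangular endomorphisms *)

(** The weight is part of the condition so that inverses are graded too. *)
Definition triangular (m : zindex -> nat) (f : HH -> HH) : Prop :=
  forall s, exists2 d : rat, d != 0 &
    supp_in (fun w => weight w = weight s /\ (m w < m s)%N) (f << s >> - d *: << s >>).

(** Preimages of basis vectors combine to preimages of linear combinations. *)
Lemma lift_supp_in (f : {linear HH -> HH}) (P Q : zindex -> Prop) u :
  (forall s, P s -> exists2 v, supp_in Q v & f v = << s >>) ->
  supp_in P u -> exists2 v, supp_in Q v & f v = u.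
Proof.
move=> lift Pu; rewrite (malg_sumE u) big_seq.
pose G x := exists2 v, supp_in Q v & f v = x.
apply: (big_ind G) => [|x y [v Qv <-] [w Qw <-]|s su].
- by exists 0; [exact: supp_in0 | exact: linear0].
- by exists (v + w); [exact: supp_inD | exact: linearD].
have [v Qv fv] := lift s (Pu s su).
by exists (u@_s *: v); [exact: supp_inZ | rewrite linearZ fv].
Qed.

(** Back substitution, by induction on the measure.  The right inverse is again
    triangular, which is what triangular_bij needs. *)
Lemma triangular_rinv m (f : {linear HH -> HH}) : triangular m f ->
  exists2 g : {linear HH -> HH}, triangular m g & cancel g f.
Proof.
move=> tf; pose low s w := weight w = weight s /\ (m w < m s)%N.
(* f s = d s + lower terms, and a preimage of the lower terms is known: the
   preimage of s is d^-1 (s - that preimage), with diagonal entry d^-1. *)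
have preim s : exists v, f v = << s >> /\
    exists2 d : rat, d != 0 & supp_in (low s) (v - d *: << s >>).
  have [n] := ubnP (m s); elim: n s => // n IHn s sn.
  have [d d0 fs] := tf s.
  have [v vs fv] : exists2 v, supp_in (low s) v & f v = f << s >> - d *: << s >>.
    apply: lift_supp_in fs => t [wt mt].
    have [v [fv [e _ vt]]] := IHn t (leq_trans mt (sn : (m s <= n)%N)).
    exists v; rewrite // -(subrK (e *: << t >>) v); apply: supp_inD.
      by apply: sub_supp_in vt => w [ww mw]; rewrite /low ww wt (ltn_trans mw).
    by apply: supp_inZ; apply: supp_inU.
  exists (d^-1 *: (<< s >> - v)); split.
    by rewrite linearZ linearB /= fv subKr scalerA mulVf // scale1r.
  exists d^-1; first by rewrite invr_eq0.
  rewrite -scalerBr; apply: supp_inZ; rewrite addrC addKr; exact: supp_inN.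
have [g0 gP] := choice preim.
exists (lext g0 : {linear HH -> HH}).
  by move=> s; have [_] := gP s; rewrite -{1}(lextU g0 s).
move=> u; apply: (@malg_linear_eq _ _ (f \o lext g0) idfun) => s.
exact: etrans (congr1 f (lextU g0 s)) (proj1 (gP s)).
Qed.

(** The right inverse g of f has itself a right inverse h, and then
    f = f g h = h, so g is a two-sided inverse of f. *)
Lemma triangular_bij m (f : {linear HH -> HH}) : triangular m f ->
  exists g : {linear HH -> HH}, [/\ triangular m g, cancel f g & cancel g f].
Proof.
move=> /triangular_rinv[g tg gK]; exists g; split=> // u.
have [h _ hK] := triangular_rinv tg.
have fh v : f v = h v by rewrite -{1}(hK v) gK.
by rewrite fh hK.
Qed.

Lemma triangular_homog m (f : {linear HH -> HH}) n u :
  triangular m f -> Hhomog n u -> Hhomog n (f u).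
Proof.
move=> tf; apply: (@supp_in_linear _ _ (fun s => weight s = n)
  (fun s => weight s = n) f) => s <-.
have [d _ fs] := tf s; rewrite -(subrK (d *: << s >>) (f _)).
apply: supp_inD; first by apply: sub_supp_in fs => w [].
by apply: supp_inZ; apply: supp_inU.
Qed.

(** * Homomorphisms in terms of the divided-power basis *)

Definition dpow_map : {linear HH -> HH} := lext dpow.

Lemma dpow_mapU s : dpow_map << s >> = dpow s.
Proof. exact: lextU. Qed.

Lemma dpow_map_triangular : triangular moment dpow_map.
Proof.
move=> s; exists 1; first exact: oner_neq0.
by rewrite scale1r dpow_mapU; apply: sub_supp_in (@dpow_triangular s) => w [].
Qed.

Lemma dpow_letter a : dpow [:: a] = << [:: a] >>.
Proof.
apply/eqP; rewrite -subr_eq0; apply/eqP.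
apply: (@supp_in_linear_eq _ _ (below [:: a]) idfun (\0 : {linear HH -> HH})).
  by move=> w []; rewrite /= weight_nil.
exact: dpow_triangular.
Qed.

Lemma Hcounit_dpow s : Hcounit (dpow s) = (s == [::])%:R.
Proof.
case: s => [|a s]; first by rewrite dpow_nil; exact: HcounitU.
by apply: mcoeff_outdom; apply/negP => /dpow_supp[].
Qed.

(** Left inverse of Ddec away from the constant term.  It only uses left factors of
    depth 1, on which a graded map into the quasi-shuffle algebra is read off by chiQ. *)
Definition glue : {linear HH2 -> HH} :=
  lext (fun p => if p.1 is [:: a] then << a :: p.2 >> else 0).

Lemma glueU p q : glue << (p, q) >> = if p is [:: a] then << a :: q >> else 0.
Proof. exact: lextU. Qed.

(** Only the cut after the first letter has a left factor of depth 1. *)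
Lemma glue_Ddec u : glue (Ddec u) = u - Hcounit u *: Hone.
Proof.
have Ls : linear (fun u => u - Hcounit u *: Hone : HH).
  move=> a x y; rewrite (functionalD Hcounit_is_linear) (functionalZ _ _ Hcounit_is_linear).
  by rewrite scalerDl scalerBr scalerA opprD addrACA.
apply: (@malg_linear_eq _ _ (glue \o Ddec) (linear_of Ls)) => s.
rewrite [LHS]/= Ddec_cut_sum [RHS]/= HcounitU.
case: s => [|a s]; first by rewrite glueU scale1r subrr.
rewrite scale0r subr0 [cut_sum _ _]/= linearD /= glueU add0r.
case: s => [|b s]; first exact: glueU.
rewrite [cut_sum _ _]/= linearD /= glueU raddf_cut_sum.
rewrite (eq_cut_sum _ (h' := fun _ _ => 0)) ?cut_sum0 ?addr0 // => p q.
exact: glueU.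
Qed.

(** A homogeneous element of weight n > 0 has a single possible component of depth
    1, the letter n, and chiQ reads its coefficient. *)
Lemma glue_tens n u v : (0 < n)%N -> Hhomog n u ->
  glue (tens u v) = chiQ u *: lcons (mkpos n.-1) v.
Proof.
move=> n0 un; apply: (@linear_tens_eqE _ _ _ glue
  (fun u v => chiQ u *: lcons (mkpos n.-1) v)).
- move=> w a x y; rewrite (functionalD chiQ_is_linear) (functionalZ _ _ chiQ_is_linear).
  by rewrite scalerDl scalerA.
- by move=> w a x y; rewrite linearP scalerDr !scalerA mulrC.
move=> p q pu _; rewrite glueU chiQU lconsU; have := un p pu.
case: p {pu} => [|a [|b p]]; rewrite ?weight_nil ?weight_cons.
- by move=> n_0; rewrite -n_0 in n0.
- rewrite weight_nil addn0 scale1r => an; congr (<< _ :: _ >>).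
  by apply: val_inj; rewrite /= -an prednK // (valP a).
by rewrite scale0r.
Qed.

Lemma glue_tens1 v : glue (tens Hone v) = 0.
Proof.
apply: (@malg_linear_eq _ _ (glue \o tens Hone) (\0 : {linear HH -> HH})) => s.
by rewrite [LHS]/= tensUU glueU.
Qed.

(** * The bijection between characters and homomorphisms *)

Lemma shuffleHl v : linear (shuffleH^~ v).
Proof.
by move=> a x y; rewrite /shuffleH (linearP rho) shuffle_is_linearl (linearP unrho).
Qed.

Lemma shuffleHr u : linear (shuffleH u).
Proof. by move=> a x y; rewrite /shuffleH !linearP. Qed.

Lemma hopf_iso_inv m1 D1 m2 D2 (f g : HH -> HH) :
  graded_hopf_hom m1 D1 m2 D2 f -> linear g -> cancel f g -> cancel g f ->
  (forall n u, Hhomog n u -> Hhomog n (g u)) ->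
  graded_hopf_hom m2 D2 m1 D1 g.
Proof.
move=> hf gl fgK gfK gh; split=> //.
- by rewrite -{1}(hom_one hf) fgK.
- by move=> u v; rewrite -{1}(gfK u) -{1}(gfK v) -(hom_mul hf) fgK.
- by move=> u; rewrite -{2}(gfK u) (hom_counit hf).
move=> u; rewrite -{1}(gfK u) -(hom_comul hf).
pose fL := linear_of (hom_linear hf); pose gL := linear_of gl.
apply: (@malg_linear_eq _ _ (tmap gL gL \o tmap fL fL) idfun) => -[p q].
rewrite -tensUU [LHS]/= (tmap_tens fL fL) (tmap_tens gL gL) /=.
by rewrite !fgK.
Qed.

Section Hom.
Variable D : HH -> HH2.
Hypothesis hD : is_Delta_ge1 D.

(** Applying glue to Ddec (f (dpow s)) expresses f (dpow s) through the values of
    f on the tails of s; this is the recursion of char_hom. *)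
Lemma hom_dpow f : graded_hopf_hom shuffleH D qshuffleH Ddec f ->
  forall s, f (dpow s) = char_hom (fun w => chiQ (f (dpow w))) s.
Proof.
move=> hf s; have [n] := ubnP (size s); elim: n s => // n IHn [|a s] sn.
  by rewrite dpow_nil (hom_one hf).
pose fL := linear_of (hom_linear hf).
have homog p : Hhomog (weight p) (f (dpow p)).
  by apply: (hom_graded hf) => w /dpow_supp[].
have f0 : Hcounit (f (dpow (a :: s))) = 0.
  by rewrite (hom_counit hf) Hcounit_dpow.
rewrite -[LHS]subr0 -(scale0r Hone) -f0 -glue_Ddec -(hom_comul hf) (Delta_dpow hD).
have tmapE p q : glue (tmap fL fL (tens (dpow p) (dpow q))) = glue (tens (f (dpow p)) (f (dpow q))).
  by rewrite (tmap_tens fL fL).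
rewrite (raddf_cut_sum (tmap fL fL)) raddf_cut_sum (eq_cut_sum _ tmapE).
have head0 v : glue (tens (f (dpow [::])) v) = 0.
  by rewrite [dpow [::]]dpow_nil (hom_one hf); exact: glue_tens1.
apply: etrans (congr1 (fun x => x + _) (head0 _)) _; rewrite add0r char_hom_cons.
apply: eq_cut_sum_cat => p q pq.
rewrite (glue_tens _ _ (homog (a :: p))); last by rewrite lt0n weight_eq0.
by rewrite (IHn _ (size_cut pq sn)).
Qed.

Lemma char_dpow chi : character chi ->
  chi (dpow [::]) = 1 /\
  forall s t, shuffle_sum s t (fun w => chi (dpow w)) = chi (dpow s) * chi (dpow t).
Proof.
move=> hchi; split=> [|s t]; first by rewrite dpow_nil (char_one hchi).
have cl : linear (chi : HH -> rat^o) := char_linear hchi.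
rewrite -(char_mul hchi) shuffleH_dpow; apply: esym.
exact: (raddf_shuffle_sum (linear_of cl)).
Qed.

Lemma hom_char f : graded_hopf_hom shuffleH D qshuffleH Ddec f -> character (chiQ \o f).
Proof.
move=> hf; split=> [a u v||u v] /=.
- by rewrite (hom_linear hf) chiQ_is_linear.
- by rewrite (hom_one hf); exact: chiQU.
- by rewrite (hom_mul hf) chiQ_mul.
Qed.

(** The formula of hom_dpow, taken as a definition on the basis dpow. *)
Lemma Psi_construction chi : character chi ->
  exists f : {linear HH -> HH},
    [/\ graded_hopf_hom shuffleH D qshuffleH Ddec f, chiQ \o f = chi &
        forall s, f (dpow s) = char_hom (fun w => chi (dpow w)) s].
Proof.
move=> hchi; pose c w := chi (dpow w); have [c1 cM] := char_dpow hchi.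
have [dpow_map' [dpow_map't dpow_mapK dpow_map'K]] := triangular_bij dpow_map_triangular.
have [f fE fdef] : exists2 f : {linear HH -> HH},
    forall s, f (dpow s) = char_hom c s & forall u, f u = lext (char_hom c) (dpow_map' u).
  exists (lext (char_hom c) \o dpow_map') => // s.
  by rewrite /= -dpow_mapU dpow_mapK; exact: lextU.
exists f; split=> //; last first.
  apply/funext => u; rewrite -(dpow_map'K u).
  have cl : linear (chi : HH -> rat^o) := char_linear hchi.
  apply: (@malg_linear_eq _ _ (linear_of chiQ_is_linear \o f \o dpow_map)
    (linear_of cl \o dpow_map)) => s.
  by rewrite [LHS]/= [RHS]/= dpow_mapU fE; exact: chiQ_char_hom.
split.
- exact: linearP.
- by rewrite -{1}dpow_nil fE.
- move=> u v; rewrite -(dpow_map'K u) -(dpow_map'K v).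
  apply: (@bilinear_eq _ _ _ (fun u v => f (shuffleH (dpow_map u) (dpow_map v)))
    (fun u v => qshuffleH (f (dpow_map u)) (f (dpow_map v)))).
  + by move=> w a x y; rewrite (linearP dpow_map) shuffleHl linearP.
  + by move=> w a x y; rewrite (linearP dpow_map) shuffleHr linearP.
  + by move=> w a x y; rewrite (linearP dpow_map) linearP qshuffle_is_linearl.
  + by move=> w a x y; rewrite !linearP.
  move=> s t _ _; rewrite !dpow_mapU shuffleH_dpow raddf_shuffle_sum !fE -char_hom_mul //.
  by apply: eq_shuffle_sum => w; apply: fE.
- move=> u; rewrite -(dpow_map'K u).
  apply: (@malg_linear_eq _ _ (linear_of Hcounit_is_linear \o f \o dpow_map)
    (linear_of Hcounit_is_linear \o dpow_map)) => s.
  by rewrite [LHS]/= [RHS]/= dpow_mapU fE Hcounit_char_hom Hcounit_dpow.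
- move=> u; rewrite -(dpow_map'K u).
  pose DL := linear_of (Delta_linear hD).
  apply: (@malg_linear_eq _ _ (tmap f f \o DL \o dpow_map) (Ddec \o f \o dpow_map)) => s.
  rewrite [LHS]/= [RHS]/= dpow_mapU fE Ddec_char_hom (Delta_dpow hD) (raddf_cut_sum (tmap f f)).
  by apply: eq_cut_sum => p q; apply: etrans (tmap_tens f f _ _) _; rewrite !fE.
move=> n u un; have := triangular_homog dpow_map't un.
rewrite fdef; apply: supp_in_linear => s <-; rewrite [X in supp_in _ X]lextU.
by apply: sub_supp_in (@char_hom_supp c s) => w [].
Qed.

Lemma hom_ext f g : graded_hopf_hom shuffleH D qshuffleH Ddec f ->
  graded_hopf_hom shuffleH D qshuffleH Ddec g -> chiQ \o f = chiQ \o g -> f = g.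
Proof.
move=> hf hg fg; have [dpow_map' [_ _ dpow_map'K]] := triangular_bij dpow_map_triangular.
apply/funext => u; rewrite -(dpow_map'K u).
apply: (@malg_linear_eq _ _ (linear_of (hom_linear hf) \o dpow_map)
  (linear_of (hom_linear hg) \o dpow_map)) => s.
rewrite [LHS]/= [RHS]/= dpow_mapU (hom_dpow hf) (hom_dpow hg).
suff -> : (fun w => chiQ (f (dpow w))) = (fun w => chiQ (g (dpow w))) by [].
by apply/funext => w; apply: (congr1 (@^~ (dpow w)) fg).
Qed.

Lemma Psi_spec chi : character chi ->
  graded_hopf_hom shuffleH D qshuffleH Ddec (Psi D chi) /\ chiQ \o Psi D chi = chi.
Proof.
move=> hchi; rewrite /Psi; have [f [hf fchi _]] := Psi_construction hchi.
have := @xgetPex _ (fun=> 0) [set f | graded_hopf_hom shuffleH D qshuffleH Ddec f /\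
  chiQ \o f = chi]%classic.
by apply; exists (f : HH -> HH).
Qed.

Lemma Psi_chiQ f : graded_hopf_hom shuffleH D qshuffleH Ddec f -> Psi D (chiQ \o f) = f.
Proof. by move=> hf; have [hP] := Psi_spec (hom_char hf); apply: hom_ext. Qed.

(** f [a] is the multiple chiQ (f [a]) of [a], because [a] has no proper cut. *)
Lemma chi_letter_neq0 f a : graded_hopf_iso shuffleH D qshuffleH Ddec f ->
  chiQ (f << [:: a] >>) != 0.
Proof.
move=> [hf [g [_ fK _]]]; apply/eqP => fa0.
have f0 : f 0 = 0 by exact: (linear0 (linear_of (hom_linear hf))).
have : f << [:: a] >> = f 0.
  rewrite f0 -dpow_letter (hom_dpow hf) char_hom_cons /=.
  by rewrite dpow_letter fa0 scale0r.
move/(can_inj fK)/malgP/(_ [:: a]); rewrite mcoeffU eqxx mcoeff0.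
by move/eqP; rewrite oner_eq0.
Qed.

(** The diagonal of char_hom c is a product of values c [a] = chi [a]. *)
Lemma Psi_iso chi : character chi -> (forall a, chi << [:: a] >> != 0) ->
  graded_hopf_iso shuffleH D qshuffleH Ddec (Psi D chi).
Proof.
move=> hchi chi0; have [hP Pchi] := Psi_spec hchi; split=> //.
pose c w := chi (dpow w).
have tF : triangular size (lext (char_hom c) : {linear HH -> HH}).
  move=> s; exists (diag c s); last by rewrite [X in X - _]lextU; exact: char_hom_triangular.
  by rewrite /diag big_seq prodf_seq_neq0; apply/allP => a _; rewrite /c dpow_letter chi0 implybT.
have [G [tG FG GF]] := triangular_bij tF.
have [dpow_map' [dpow_map't dpow_mapK dpow_map'K]] := triangular_bij dpow_map_triangular.
have PE u : Psi D chi (dpow_map u) = lext (char_hom c) u.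
  apply: (@malg_linear_eq _ _ (linear_of (hom_linear hP) \o dpow_map) (lext (char_hom c))) => s.
  rewrite [LHS]/= dpow_mapU (hom_dpow hP) [RHS]lextU; congr (char_hom _ s); apply/funext => w.
  exact: (congr1 (@^~ (dpow w)) Pchi).
have gK : cancel (Psi D chi) (dpow_map \o G).
  by move=> u; rewrite -(dpow_map'K u) PE /= FG.
have Kg : cancel (dpow_map \o G) (Psi D chi) by move=> u; rewrite /= PE GF.
exists (dpow_map \o G); split=> //; apply: hopf_iso_inv hP _ gK Kg _; first exact: linearP.
by move=> n u un; apply: triangular_homog dpow_map_triangular _; apply: triangular_homog tG un.
Qed.

End Hom.

Local Open Scope classical_set_scope.

Theorem theorem3p12 (D : HH -> HH2) (hD : is_Delta_ge1 D) :
  set_bij [set chi | character chi]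
          [set f | graded_hopf_hom shuffleH D qshuffleH Ddec f]
          (Psi D)
  /\
  set_bij [set chi | character chi /\ forall s : posint, chi << [:: s] >> != 0]
          [set f | graded_hopf_iso shuffleH D qshuffleH Ddec f]
          (Psi D).
Proof.
have inj chi chi' : character chi -> character chi' -> Psi D chi = Psi D chi' -> chi = chi'.
  by move=> /(Psi_spec hD)[_ {2}<-] /(Psi_spec hD)[_ {2}<-] ->.
split; split.
- by move=> chi /(Psi_spec hD)[].
- by move=> chi chi' /set_mem hc /set_mem hc'; apply: inj.
- by move=> f hf; exists (chiQ \o f); [exact: hom_char hf | exact: Psi_chiQ].
- by move=> chi [hc c0]; apply: Psi_iso.
- by move=> chi chi' /set_mem[hc _] /set_mem[hc' _]; apply: inj.
move=> f hf; exists (chiQ \o f); last exact: Psi_chiQ (proj1 hf).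
by split=> [|a]; [exact: hom_char (proj1 hf) | exact: chi_letter_neq0 hf].
Qed.
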